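(* There exist absolute constants $d_*,d'_*>0$ such that the following holds. For every $\delta>0$ there is a number $A(\delta)$ such that for every $A\ge A(\delta)$ there exists a function $f\in\mathfrak C_0$ with constants $d_f=d_*$, $d'_f=d'_*$ such that $$ |f(0)|\ge\exp(-A)\qquad\text{and}\qquad N_f\ge\exp\bigl(A^{1/2-\delta}\bigr). $$
   Context: $\mathbb D(r)=\{|z|<r\}$, $\mathbb D=\mathbb D(1)$, $m_2$ is planar Lebesgue measure. $f\in\mathfrak C_0$ with constants $d_f,d_f'>0$ means that $f$ is analytic in $\mathbb D$ and is the planar Cauchy transform $f(z)=\frac1\pi\int_{\mathbb D(2)\setminus\mathbb D}\frac{\varphi(\zeta)}{z-\zeta}\,dm_2(\zeta)$ of a function $\varphi$ supported in $\mathbb D(2)\setminus\mathbb D$ with $|\varphi(z)|\le d_f'\exp\Bigl(-\frac{1}{d_f(|z|-1)}\Bigr)$ for $1<|z|<2$. Such $f$ is smooth up to the boundary of $\mathbb D$. $N_f={\rm card}\,(Z_f\cap\overline{\mathbb D})$ denotes the number of zeros of $f$ in the closed unit disc. *)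

(* Defs.v *)
From HB Require Import structures.
From mathcomp Require Import all_boot all_order all_algebra.
From mathcomp Require Import all_classical all_reals all_analysis.
From mathcomp Require Export complex.
Set Implicit Arguments.
Unset Strict Implicit.
Unset Printing Implicit Defensive.
Import Order.TTheory GRing.Theory Num.Theory.
Import numFieldNormedType.Exports.
Local Open Scope classical_set_scope.
Local Open Scope ring_scope.
Local Open Scope complex_scope.

(* The norm `|z| of z : R[i] takes its values in R[i]; the modulus as an
   element of R is ComplexField.Normc.normc z. *)
Notation cmod := ComplexField.Normc.normc.

Section Definitions.
Context {R : realType}.
Implicit Types (D : set R[i]) (f g phi : R[i] -> R[i]) (z : R[i]) (r : R).

Definition disc r : set R[i] := [set z | cmod z < r].
Definition cdisc r : set R[i] := [set z | cmod z <= r].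

(* The complex plane carries no measurable structure in the library: complex
   functions are measured and integrated through the identification of R * R
   (with its Borel sigma-algebra) with R[i]. *)
Definition to_complex (p : measurableTypeR R * measurableTypeR R) : R[i] :=
  p.1 +i* p.2.

Definition planar_lebesgue :
    set (measurableTypeR R * measurableTypeR R) -> \bar R :=
  (@lebesgue_measure R \x @lebesgue_measure R)%E.

Definition planar_measurable g : Prop :=
  measurable_fun setT (fun p => complex.Re (g (to_complex p))) /\
  measurable_fun setT (fun p => complex.Im (g (to_complex p))).

Definition planar_integral D g : R[i] :=
  Rintegral planar_lebesgue (to_complex @^-1` D)
    (fun p => complex.Re (g (to_complex p)))
  +i* Rintegral planar_lebesgue (to_complex @^-1` D)
    (fun p => complex.Im (g (to_complex p))).

Definition cauchy_transform phi z : R[i] :=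
  (pi^-1)%:C *
  planar_integral (disc 2 `\` disc 1) (fun zeta => phi zeta / (z - zeta)).

(* As R[i]^o is a normed module over the field R[i], the derivative in the
   direction 1 is the complex derivative. *)
Definition analytic_on D f : Prop :=
  forall z, D z -> derivable (f : R[i]^o -> R[i]^o) z 1.

Definition classC0 (d d' : R) f : Prop :=
  analytic_on (disc 1) f /\
  exists phi : R[i] -> R[i],
    [/\ planar_measurable phi,
        forall z, ~ (disc 2 `\` disc 1) z -> phi z = 0,
        forall z, 1 < cmod z < 2 ->
          cmod (phi z) <= d' * expR (- (d * (cmod z - 1))^-1) &
        forall z, f z = cauchy_transform phi z].

Definition zero_set f : set R[i] := [set z | f z = 0].

(* Zeros are counted without multiplicity, with value +oo if there are
   infinitely many. *)
Definition nb_zeros f : \bar R := counting (zero_set f `&` cdisc 1).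

End Definitions.

(* Main.v *)
Require Import Defs.
From mathcomp Require Import all_boot all_order all_algebra.
From mathcomp Require Import all_classical all_reals all_analysis.
From mathcomp Require Import measurable_realfun ring lra zify.
Import Order.TTheory GRing.Theory Num.Theory.
Local Open Scope ring_scope.

(** A polynomial [p] with [|p_n| <= exp (- c sqrt n)] coincides on the closed
disc with a function of the class, whose constants depend on [c] only: the
monomial [z ^ n] is the Cauchy transform of a multiple of [w ^ (n + 1)]
restricted to a ring at distance of order [1 / sqrt n] from the unit circle. The
integrals over rings are evaluated without polar coordinates: expand the kernel
in powers of [z / w]; every power of [w] but the zeroth integrates to [0] by
invariance under the rotation by [(3 + 4i) / 5], which is a product of three
shears and has infinite order.

It remains to find a polynomial with such coefficients, with [p_0 = exp (- A)]
and with many zeros in [[0, 1]]. Let the nonzero coefficients sit at [0] and at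
positive integers [t_1, ..., t_N], and take for [p_n] the coefficients of the
divided difference at the points [q ^ n]; then [q ^ i] is a zero for [i < N].
For [q] close to [1], [|p_x / p_0|] is at most twice the inverse of the product
of [|x - y| / y] over the nodes [y] other than [x]. The nodes [k ^ 2 + l], with
[l < L] and [2 L <= k <= 2 ^ l], make this product at least
[exp (c sqrt x - C L^2 ln L)], while [N >= 2 ^ (L - 2)]. Thus
[A] of order [L ^ 2 ln L] suffices. *)

Set Implicit Arguments.
Unset Strict Implicit.
Unset Printing Implicit Defensive.

(** * Rotation invariance of planar Lebesgue measure *)

Section Rotation.
Local Open Scope classical_set_scope.
Context {R : realType}.
Notation lam := (@lebesgue_measure R).
Notation plane := (measurableTypeR R * measurableTypeR R)%type.
Notation mu := (lam \x lam)%E.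

Lemma measurable_addr (c : R) :
  measurable_fun setT ((fun x => x + c) : measurableTypeR R ->
    measurableTypeR R).
Proof.
by apply: measurable_funD; [exact: measurable_id|exact: measurable_cst].
Qed.

(** The image of Lebesgue measure under the translation agrees with it on half-open intervals, and
    this determines the measure. *)
Lemma lebesgue_measure_translation (c : R) (A : set (measurableTypeR R)) :
  measurable A -> lam ((fun x => x + c) @^-1` A) = lam A.
Proof.
move=> mA; apply/esym.
pose f := (fun x => x + c) : measurableTypeR R -> measurableTypeR R.
have mf : measurable_fun setT f := measurable_addr c.
pose f' : {mfun measurableTypeR R >-> measurableTypeR R} :=
  mfun_Sub (mem_set mf).
rewrite (@lebesgue_measure_unique R (pushforward lam f')) //.
move=> X [[a b] _ <-]; rewrite /= /pushforward.
rewrite (_ : _ @^-1` _ = `]a - c, b - c]%classic); last first.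
  by apply/seteqP; split => x /=; rewrite !in_itv /= /f ltrBlDr lerBrDr.
rewrite !lebesgue_measure_itv /= !lte_fin ltrD2r; case: ifP => // _.
by rewrite -!EFinD; congr EFin; ring.
Qed.

Lemma measurable_shear_fst (t : R) :
  measurable_fun [set: plane] (fun p : plane => (p.1 + t * p.2, p.2) : plane).
Proof.
apply: measurable_fun_pair; last exact: measurable_snd.
apply: measurable_funD; first exact: measurable_fst.
by apply: measurable_funM; [exact: measurable_cst|exact: measurable_snd].
Qed.

Lemma measurable_shear_snd (t : R) :
  measurable_fun [set: plane] (fun p : plane => (p.1, p.2 + t * p.1) : plane).
Proof.
apply: measurable_fun_pair; first exact: measurable_fst.
apply: measurable_funD; first exact: measurable_snd.
by apply: measurable_funM; [exact: measurable_cst|exact: measurable_fst].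
Qed.

Lemma shear_snd_measure (t : R) (A : set plane) : measurable A ->
  mu ((fun p => (p.1, p.2 + t * p.1)) @^-1` A) = mu A.
Proof.
move=> mA; rewrite /product_measure1; apply: eq_integral => x _ /=.
rewrite (_ : xsection _ x = (fun y => y + t * x) @^-1` xsection A x);
  last first.
  by apply/seteqP; split => y; rewrite /xsection /= !inE.
by rewrite lebesgue_measure_translation//; exact: measurable_xsection.
Qed.

(** A shear along the first axis translates horizontal sections, while [\x] integrates vertical
    ones; hence the passage to [\x^], equal to [\x] by uniqueness of the product measure. *)
Lemma shear_fst_measure (t : R) (A : set plane) : measurable A ->
  mu ((fun p => (p.1 + t * p.2, p.2)) @^-1` A) = mu A.
Proof.
have E (X : set plane) : measurable X -> mu X = (lam \x^ lam)%E X.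
  by apply: product_measure_unique => B C mB mC /=; rewrite product_measure2E.
move=> mA; rewrite !E//; last first.
  by rewrite -[X in measurable X]setTI; exact: measurable_shear_fst.
rewrite /product_measure2; apply: eq_integral => y _ /=.
rewrite (_ : ysection _ y = (fun x => x + t * y) @^-1` ysection A y);
  last first.
  by apply/seteqP; split => x; rewrite /ysection /= !inE.
by rewrite lebesgue_measure_translation//; exact: measurable_ysection.
Qed.

Definition rot345 (p : plane) : plane :=
  ((3 * p.1 - 4 * p.2) / 5, (4 * p.1 + 3 * p.2) / 5).

(** The rotation by the angle [a] with cosine 3/5 and sine 4/5 splits into shears of slopes - tan (a
    / 2), sin a and - tan (a / 2). *)
Lemma rot345_shears (p : plane) : let t := - 2^-1 in let s := 4 / 5 in
  rot345 p = let x := p.1 + t * p.2 in let y := p.2 + s * x in (x + t * y, y).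
Proof. by rewrite /rot345; congr pair => /=; field. Qed.

Lemma measurable_rot345 : measurable_fun setT rot345.
Proof.
pose t : R := - 2^-1; pose s : R := 4 / 5.
have -> : rot345 = (fun p : plane => (p.1 + t * p.2, p.2) : plane) \o
   (fun p : plane => (p.1, p.2 + s * p.1) : plane) \o
   (fun p : plane => (p.1 + t * p.2, p.2) : plane).
  by apply/funext => p; rewrite rot345_shears.
apply: measurableT_comp; last exact: measurable_shear_fst.
by apply: measurableT_comp;
  [exact: measurable_shear_fst|exact: measurable_shear_snd].
Qed.

Lemma rot345_measure (A : set plane) : measurable A -> mu (rot345 @^-1` A) =
  mu A.
Proof.
move=> mA; pose t : R := - 2^-1; pose s : R := 4 / 5.
rewrite -(shear_fst_measure t mA).
have m1 : measurable ((fun p : plane => (p.1 + t * p.2, p.2)) @^-1` A).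
  by rewrite -[X in measurable X]setTI; exact: measurable_shear_fst.
rewrite -(shear_snd_measure s m1).
have m2 : measurable ((fun p : plane => (p.1, p.2 + s * p.1)) @^-1`
     ((fun p : plane => (p.1 + t * p.2, p.2)) @^-1` A)).
  by rewrite -[X in measurable X]setTI; exact: measurable_shear_snd.
rewrite -(shear_fst_measure t m2); congr (mu _).
by apply/seteqP; split => p /=; rewrite rot345_shears.
Qed.
End Rotation.

(** * Modulus and planar measurability *)

Section Modulus.
Local Open Scope complex_scope.
Import ComplexField.Normc.
Context {R : realType}.
Implicit Types (z w : R[i]).

Lemma cmodE z : cmod z = Num.sqrt (complex.Re z ^+ 2 + complex.Im z ^+ 2).
Proof. by case: z. Qed.

Lemma cmod_ge0 z : 0 <= cmod z.
Proof. by rewrite cmodE sqrtr_ge0. Qed.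

Lemma cmod_real (x : R) : cmod x%:C = `|x|.
Proof. by rewrite cmodE /= expr0n addr0 sqrtr_sqr. Qed.

Lemma cmodD z w : cmod (z + w) <= cmod z + cmod w.
Proof. exact: le_normcD. Qed.

Lemma cmodN z : cmod (- z) = cmod z.
Proof. exact: normcN. Qed.

Lemma cmodB_ge z w : cmod w - cmod z <= cmod (z - w).
Proof.
rewrite lerBlDl -(cmodN (z - w)) opprB; apply: le_trans (cmodD _ _).
by rewrite addrC subrK.
Qed.

Lemma cmodX z n : cmod (z ^+ n) = cmod z ^+ n.
Proof. by elim: n => [|n IH]; rewrite ?normc1// !exprS normcM IH. Qed.

Lemma cmod_sum (I : Type) (r : seq I) (P : pred I) (F : I -> R[i]) :
  cmod (\sum_(i <- r | P i) F i) <= \sum_(i <- r | P i) cmod (F i).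
Proof.
elim/big_rec2: _ => [|i x y _ le]; first by rewrite normc0.
by apply: le_trans (cmodD _ _) _; rewrite lerD2l.
Qed.

Lemma Re_le_cmod z : `|complex.Re z| <= cmod z.
Proof.
rewrite cmodE -sqrtr_sqr; apply: ler_wsqrtr; rewrite lerDl; exact: sqr_ge0.
Qed.

Lemma Im_le_cmod z : `|complex.Im z| <= cmod z.
Proof.
rewrite cmodE -sqrtr_sqr; apply: ler_wsqrtr; rewrite lerDr; exact: sqr_ge0.
Qed.

Lemma cmod_le_ReIm z : cmod z <= `|complex.Re z| + `|complex.Im z|.
Proof.
rewrite cmodE -[leRHS]ger0_norm ?addr_ge0// -sqrtr_sqr; apply: ler_wsqrtr.
rewrite sqrrD !real_normK ?num_real// lerD2r lerDl.
by rewrite mulrn_wge0// mulr_ge0.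
Qed.
End Modulus.

Section PlanarMeasurable.
Local Open Scope classical_set_scope.
Local Open Scope complex_scope.
Context {R : realType}.
Implicit Types (f g : R[i] -> R[i]) (z : R[i]).

Lemma planar_measurable_cst c : planar_measurable (fun=> c : R[i]).
Proof. by split; exact: measurable_cst. Qed.

Lemma planar_measurable_id : planar_measurable (fun z : R[i] => z).
Proof. by split; [exact: measurable_fst|exact: measurable_snd]. Qed.

Lemma planar_measurableD f g : planar_measurable f -> planar_measurable g ->
  planar_measurable (fun z => f z + g z).
Proof.
move=> [f1 f2] [g1 g2]; split.
- rewrite (_ : (fun p => _) = (fun p => complex.Re (f (to_complex p))) \+
   (fun p => complex.Re (g (to_complex p)))); first exact: measurable_funD.
  by apply/funext => p /=; case: (f _) => a b; case: (g _).
- rewrite (_ : (fun p => _) = (fun p => complex.Im (f (to_complex p))) \+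
   (fun p => complex.Im (g (to_complex p)))); first exact: measurable_funD.
  by apply/funext => p /=; case: (f _) => a b; case: (g _).
Qed.

Lemma planar_measurableM f g : planar_measurable f -> planar_measurable g ->
  planar_measurable (fun z => f z * g z).
Proof.
move=> [f1 f2] [g1 g2]; split.
- rewrite (_ : (fun p => _) =
     (fun p => complex.Re (f (to_complex p))) \*
       (fun p => complex.Re (g (to_complex p)))
  \- (fun p => complex.Im (f (to_complex p))) \*
    (fun p => complex.Im (g (to_complex p)))).
    by apply: measurable_funB; exact: measurable_funM.
  by apply/funext => p /=; case: (f _) => a b; case: (g _).
- rewrite (_ : (fun p => _) =
     (fun p => complex.Re (f (to_complex p))) \*
       (fun p => complex.Im (g (to_complex p)))
  \+ (fun p => complex.Im (f (to_complex p))) \*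
    (fun p => complex.Re (g (to_complex p)))).
    by apply: measurable_funD; exact: measurable_funM.
  by apply/funext => p /=; case: (f _) => a b; case: (g _).
Qed.

Lemma planar_measurableV f : planar_measurable f ->
  planar_measurable (fun z => (f z)^-1).
Proof.
move=> [f1 f2].
(* The inverse is written as a real power, for which measurability is known; where the squared
   modulus vanishes both forms equal 0. *)
pose n2 p :=
  (complex.Re (f (to_complex p)) ^+ 2 + complex.Im (f (to_complex p)) ^+ 2) `^
  (-1).
have n2E p : n2 p =
  (complex.Re (f (to_complex p)) ^+ 2 + complex.Im (f (to_complex p)) ^+ 2)^-1.
  by rewrite /n2 powR_inv1// addr_ge0 ?sqr_ge0.
have mn : measurable_fun setT n2.
  apply: (measurableT_comp (measurable_powR (-1))).
  by apply: measurable_funD; exact: measurable_funX.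
split.
- rewrite (_ : (fun p => _) = (fun p => complex.Re (f (to_complex p))) \* n2).
    exact: measurable_funM.
  by apply/funext => p /=; rewrite n2E; case: (f _) => a b.
- rewrite (_ : (fun p => _) = (fun p => - complex.Im (f (to_complex p))) \* n2).
    by apply: measurable_funM => //; exact: measurable_funN.
  by apply/funext => p /=; rewrite n2E; case: (f _) => a b; rewrite /= mulNr.
Qed.

Lemma planar_measurableX f n : planar_measurable f ->
  planar_measurable (fun z => f z ^+ n).
Proof.
move=> mf; elim: n => [|n IH]; first exact: planar_measurable_cst.
rewrite (_ : (fun z => _) = (fun z => f z * f z ^+ n));
  first exact: planar_measurableM.
by apply/funext => z; rewrite exprS.
Qed.

Lemma planar_measurable_sum (I : Type) (r : seq I) (F : I -> R[i] -> R[i]) :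
  (forall i, planar_measurable (F i)) ->
  planar_measurable (fun z => \sum_(i <- r) F i z).
Proof.
move=> mF; elim: r => [|i r IH].
  rewrite (_ : (fun z => _) = (fun=> 0)); first exact: planar_measurable_cst.
  by apply/funext => z; rewrite big_nil.
rewrite (_ : (fun z => _) = (fun z => F i z + \sum_(j <- r) F j z)).
  exact: planar_measurableD.
by apply/funext => z; rewrite big_cons.
Qed.

Lemma measurable_cmod_to_complex :
  measurable_fun setT (fun p => cmod (@to_complex R p)).
Proof.
rewrite (_ : (fun p => _) = Num.sqrt \o (fun p => p.1 ^+ 2 + p.2 ^+ 2));
  last first.
  by apply/funext => p /=.
apply: (measurableT_comp (continuous_measurable_fun (@sqrt_continuous R))).
by apply: measurable_funD; apply: measurable_funX;
  [exact: measurable_fst|exact: measurable_snd].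
Qed.

Definition ring_indicator (a b : R) (z : R[i]) : R[i] :=
  ((a <= cmod z <= b)%R%:R)%:C.

Lemma planar_measurable_ring_indicator a b :
  planar_measurable (ring_indicator a b).
Proof.
split; last exact: measurable_cst.
rewrite (_ : (fun p => _) = (fun x : R => \1_(`[a, b]%classic) x)
  \o (fun p => cmod (@to_complex R p))).
  apply: (measurableT_comp _ measurable_cmod_to_complex).
  exact: measurable_indic.
by apply/funext => p; rewrite /= indicE mem_setE in_itv.
Qed.
End PlanarMeasurable.

(** * Integrals over the annulus *)

Section AnnulusIntegral.
Local Open Scope classical_set_scope.
Local Open Scope complex_scope.
Import ComplexField.Normc.
Context {R : realType}.
Implicit Types (f g : R[i] -> R[i]) (z : R[i]).
Notation lam := (@lebesgue_measure R).
Notation plane := (measurableTypeR R * measurableTypeR R)%type.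
Notation mu := (lam \x lam)%E.

Definition annulus : set R[i] := disc 2 `\` disc 1.
Notation T := (@to_complex R @^-1` annulus).
Notation "\I g" := (planar_integral annulus g) (at level 10, g at level 8).

Lemma annulusP z : annulus z <-> 1 <= cmod z < 2.
Proof.
rewrite /annulus /disc /=; split => [[-> /negP]|/andP[h ->]].
  by rewrite -leNgt => ->.
by split => //; apply/negP; rewrite -leNgt.
Qed.

Lemma measurable_annulus : measurable T.
Proof.
have mE r : measurable (@to_complex R @^-1` disc r).
  rewrite (_ : _ @^-1` _ = setT `&` (fun p => cmod (@to_complex R p)) @^-1`
    `]-oo, r[%classic).
    by apply: measurable_cmod_to_complex => //; exact: measurable_itv.
  by apply/seteqP; split => p /=; rewrite in_itv /=; [split|case].
by apply: (measurableD (mE 2)); exact: mE.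
Qed.

Lemma annulus_finite : (mu T < +oo)%E.
Proof.
have mI : measurable (`[-2, 2]%classic : set (measurableTypeR R))
  by exact: measurable_itv.
apply: (@le_lt_trans _ _ (mu (`[-2, 2]%classic `*` `[-2, 2]%classic))).
  apply: le_measure; rewrite ?inE;
    [exact: measurable_annulus|exact: measurableX|].
  move=> [x y] /annulusP/andP[_ h]; split; rewrite /= in_itv /= -ler_norml.
    by apply: le_trans (ltW h); exact: (Re_le_cmod (x +i* y)).
  by apply: le_trans (ltW h); exact: (Im_le_cmod (x +i* y)).
by rewrite product_measure1E//= lebesgue_measure_itv /= lte_fin; case: ifP => _;
   rewrite ?mule0 ?mul0e ?ltry// -EFinB -EFinM ltry.
Qed.

(** Boundedness is asked on the annulus only, so that the inverse function qualifies; as the annulus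
    has finite measure, tame functions are integrable there. *)
Definition tame g := planar_measurable g /\
  exists M, forall z, annulus z -> cmod (g z) <= M.

Lemma tame_integrable g : tame g ->
  mu.-integrable T (EFin \o (fun p => complex.Re (g (to_complex p)))) /\
  mu.-integrable T (EFin \o (fun p => complex.Im (g (to_complex p)))).
Proof.
move=> [[m1 m2] [M hM]]; split; apply: measurable_bounded_integrable.
- exact: measurable_annulus.
- exact: annulus_finite.
- exact: measurable_funTS.
- exists M; split; rewrite ?num_real// => N MN p /= /hM h.
  by apply: le_trans (ltW MN); apply: le_trans h; exact: Re_le_cmod.
- exact: measurable_annulus.
- exact: annulus_finite.
- exact: measurable_funTS.
- exists M; split; rewrite ?num_real// => N MN p /= /hM h.
  by apply: le_trans (ltW MN); apply: le_trans h; exact: Im_le_cmod.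
Qed.

Lemma tameD f g : tame f -> tame g -> tame (fun z => f z + g z).
Proof.
move=> [mf [M hM]] [mg [N hN]]; split; first exact: planar_measurableD.
exists (M + N) => z az; apply: le_trans (cmodD _ _) _.
by apply: lerD; [exact: hM|exact: hN].
Qed.

Lemma tameM f g : tame f -> tame g -> tame (fun z => f z * g z).
Proof.
move=> [mf [M hM]] [mg [N hN]]; split; first exact: planar_measurableM.
exists (M * N) => z az; rewrite normcM.
by apply: ler_pM; rewrite ?cmod_ge0//; [exact: hM|exact: hN].
Qed.

Lemma tame_cst c : tame (fun=> c).
Proof. by split; [exact: planar_measurable_cst|exists (cmod c)]. Qed.

Lemma tame_id : tame (fun z => z).
Proof.
split; first exact: planar_measurable_id.
by exists 2 => z /annulusP/andP[_ /ltW].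
Qed.

Lemma tameX f n : tame f -> tame (fun z => f z ^+ n).
Proof.
move=> [mf [M hM]]; split; first exact: planar_measurableX.
by exists (M ^+ n) => z az; rewrite cmodX lerXn2r ?nnegrE ?cmod_ge0//
  ?(le_trans _ (hM _ az)) ?cmod_ge0// hM.
Qed.

Lemma tame_sum (I : Type) (r : seq I) (F : I -> R[i] -> R[i]) :
  (forall i, tame (F i)) -> tame (fun z => \sum_(i <- r) F i z).
Proof.
move=> tF; elim: r => [|i r IH].
  rewrite (_ : (fun z => _) = (fun=> 0)); first exact: tame_cst.
  by apply/funext => z; rewrite big_nil.
rewrite (_ : (fun z => _) = (fun z => F i z + \sum_(j <- r) F j z)).
  exact: tameD.
by apply/funext => z; rewrite big_cons.
Qed.

Lemma tame_inv : tame (fun z => z^-1).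
Proof.
split; first exact: planar_measurableV planar_measurable_id.
exists 1 => z /annulusP/andP[h _]; rewrite normcV invf_le1//.
exact: lt_le_trans h.
Qed.

Lemma tame_ring_indicator a b : tame (ring_indicator a b).
Proof.
split; first exact: planar_measurable_ring_indicator.
by exists 1 => z _; rewrite /ring_indicator cmod_real; case: (_ <= _ <= _);
  rewrite ?normr1 ?normr0 ?ler01.
Qed.

Lemma eq_pintegral f g : (forall z, annulus z -> f z = g z) -> \I f = \I g.
Proof.
move=> fg; rewrite /planar_integral; congr Complex; apply: eq_Rintegral => p;
  by rewrite inE => /= /fg ->.
Qed.

Lemma pintegralD f g : tame f -> tame g -> \I (fun z => f z + g z) =
  \I f + \I g.
Proof.
move=> /tame_integrable[f1 f2] /tame_integrable[g1 g2].
rewrite /planar_integral /planar_lebesgue; apply/eqP; rewrite eq_complex /=;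
  apply/andP.
split; apply/eqP; rewrite -RintegralD//; try exact: measurable_annulus;
  apply: eq_Rintegral => p _; by case: (f _) => a b; case: (g _).
Qed.

Lemma pintegralZ c g : tame g -> \I (fun z => c * g z) = c * \I g.
Proof.
move=> /tame_integrable[g1 g2]; case: c => a b.
have mT := measurable_annulus.
have iZ k (f : plane -> R) : mu.-integrable T (EFin \o f) ->
  mu.-integrable T (EFin \o (fun p => k * f p)).
  by move=> fi; exact: (integrableZl mT k fi).
rewrite /planar_integral /planar_lebesgue; apply/eqP; rewrite eq_complex /=;
  apply/andP.
split; apply/eqP; rewrite -!RintegralZl//.
  rewrite -RintegralB//; [|exact: iZ|exact: iZ].
  by apply: eq_Rintegral => p _; case: (g _).
rewrite -RintegralD//; [|exact: iZ|exact: iZ].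
by apply: eq_Rintegral => p _; case: (g _).
Qed.

Lemma pintegral0 : \I (fun=> 0) = 0.
Proof.
rewrite -[RHS](mul0r (\I (fun=> 0))) -(pintegralZ 0 (tame_cst 0)).
by apply: eq_pintegral => z _; rewrite mul0r.
Qed.

Lemma pintegral_sum (I : Type) (r : seq I) (F : I -> R[i] -> R[i]) :
  (forall i, tame (F i)) ->
  \I (fun z => \sum_(i <- r) F i z) = \sum_(i <- r) \I (F i).
Proof.
move=> tF; elim: r => [|i r IH].
  by rewrite big_nil -[RHS]pintegral0; apply: eq_pintegral => z _;
    rewrite big_nil.
rewrite big_cons -IH -pintegralD//; last exact: tame_sum.
by apply: eq_pintegral => z _; rewrite big_cons.
Qed.

(** [C] is twice the area of the annulus, once for each of the real and imaginary parts. Its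
    independence of [g] lets remainders of a series tend to 0. *)
Lemma pintegral_bound : exists C : R, forall g M, tame g ->
  (forall z, annulus z -> cmod (g z) <= M) -> cmod (\I g) <= C * M.
Proof.
exists (2 * fine (mu T)) => g M /[dup] tg [_ _] hM.
have [g1 g2] := tame_integrable tg.
have mT := measurable_annulus.
have cint : mu.-integrable T (EFin \o (fun=> M)).
  apply: measurable_bounded_integrable => //; first exact: annulus_finite.
  exact: bounded_cst.
have H (f : plane -> R) : mu.-integrable T (EFin \o f) ->
    (forall p, T p -> `|f p| <= M) -> `|\int[mu]_(p in T) f p| <=
      M * fine (mu T).
  move=> fi fM; apply: le_trans (le_normr_Rintegral mT fi) _.
  rewrite -Rintegral_cst//; apply: le_Rintegral => //.
  exact: integrable_norm.
apply: le_trans (cmod_le_ReIm _) _.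
rewrite (_ : 2 * _ * M = M * fine (mu T) + M * fine (mu T)); last by ring.
apply: lerD; apply: H => // p /hM; apply: le_trans;
  [exact: Re_le_cmod|exact: Im_le_cmod].
Qed.

(** * Rotation invariance of the integral and vanishing of powers *)

Definition unit345 : R[i] := (3 / 5) +i* (4 / 5).

Lemma cmod_unit345 : cmod unit345 = 1.
Proof.
by rewrite cmodE /= (_ : _ + _ = 1 ^+ 2) ?sqrtr_sqr ?normr1//; field.
Qed.

Lemma to_complex_rot345 (p : plane) : to_complex (rot345 p) =
  unit345 * to_complex p.
Proof.
by apply/eqP; rewrite eq_complex /=; apply/andP; split; apply/eqP; field.
Qed.

(** Change of variables: the rotation preserves planar measure, and it preserves the annulus because
    [unit345] has modulus 1. *)
Lemma Rintegral_rot345 (f : plane -> R) : measurable_fun setT f ->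
  mu.-integrable T (EFin \o f) ->
  \int[mu]_(p in T) f (rot345 p) = \int[mu]_(p in T) f p.
Proof.
move=> mf fi.
have mT := measurable_annulus.
have TE : rot345 @^-1` T = T.
  by apply/seteqP; split => p /=; rewrite to_complex_rot345 => /annulusP h;
    apply/annulusP; move: h; rewrite normcM cmod_unit345 mul1r.
have mrot := @measurable_rot345 R.
pose rot : {mfun plane >-> plane} := mfun_Sub (mem_set mrot).
have mf' : measurable_fun setT (EFin \o f) by exact/measurable_EFinP.
rewrite /Rintegral; congr fine; apply/esym.
have pE (h : plane -> \bar R) :
    (\int[mu]_(p in T) h p = \int[pushforward mu rot]_(p in T) h p)%E.
  by apply: eq_measure_integral => A mA _; exact/esym/rot345_measure.
have fi' : mu.-integrable (rot @^-1` T) ((EFin \o f) \o rot).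
  apply/integrableP; split.
    by apply: measurable_funTS; exact: (measurableT_comp mf' mrot).
  have /integrableP[_] := fi; rewrite pE ge0_integral_pushforward//.
  by apply: measurableT_comp => //; exact: measurable_funTS.
have := integral_pushforward mrot mf' fi' mT.
by rewrite TE => pf; apply: etrans (pE _) pf.
Qed.

Lemma pintegral_rot345 g : tame g -> \I (fun z => g (unit345 * z)) = \I g.
Proof.
move=> /[dup] /tame_integrable[g1 g2] [[m1 m2] _].
rewrite /planar_integral /planar_lebesgue; apply/eqP; rewrite eq_complex /=;
  apply/andP.
split; apply/eqP; rewrite -[RHS]Rintegral_rot345//; apply: eq_Rintegral => p _;
  by rewrite to_complex_rot345.
Qed.

(* In the Gaussian integers [(3 + 4i) ^ k] is congruent to [3 + 4i] modulo [5],
   so it is not [5 ^ k]. *)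
Lemma unit345X_neq1 k : (0 < k)%N -> unit345 ^+ k != 1.
Proof.
case: k => // k _.
have [a [b E]] : exists a b : int,
    (5%:R * unit345) ^+ k.+1 = (3 + 5 * a)%:~R +i* (4 + 5 * b)%:~R.
  elim: k => [|k [a [b IH]]].
    by exists 0, 0; rewrite !mulr0 !addr0; apply/eqP; rewrite eq_complex /=;
      apply/andP; split; apply/eqP; by field.
  exists (3 * a - 4 * b - 2), (4 * a + 3 * b + 4); rewrite exprS IH.
  apply/eqP; rewrite eq_complex /=; apply/andP; split; apply/eqP;
    rewrite !(intrD, intrM, intrB); by field.
(* If the power were 1, the left side would be a power of 5, with imaginary part 0; but [4 + 5 * b]
   is never 0. *)
apply/negP => /eqP u1; move: E; rewrite exprMn u1 mulr1 -natrX.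
rewrite -[X in X%:R]/(5 ^ k.+1)%N -(rmorph_nat (real_complex R)) => -[_ /eqP].
rewrite eq_sym intr_eq0 => /eqP; lia.
Qed.

(** Rotation invariance makes the integral equal to [c] times itself. *)
Lemma pintegral_rot_eigen g c : tame g -> c != 1 ->
  (forall z, g (unit345 * z) = c * g z) -> \I g = 0.
Proof.
move=> tg c1 gE; have := pintegral_rot345 tg.
rewrite (eq_pintegral (fun z _ => gE z)) pintegralZ// => /eqP.
rewrite -subr_eq0 -{2}[planar_integral _ _]mul1r -mulrBl mulf_eq0 subr_eq0
  (negPf c1).
by move=> /eqP.
Qed.

Lemma ring_indicator_rot a b z : ring_indicator a b (unit345 * z) =
  ring_indicator a b z.
Proof. by rewrite /ring_indicator normcM cmod_unit345 mul1r. Qed.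

Lemma pintegral_ring_pow a b k : (0 < k)%N ->
  \I (fun z => ring_indicator a b z * z ^+ k) = 0.
Proof.
move=> k0; apply: (@pintegral_rot_eigen _ (unit345 ^+ k)).
- by apply: tameM; [exact: tame_ring_indicator|apply: tameX; exact: tame_id].
- exact: unit345X_neq1.
- by move=> z; rewrite ring_indicator_rot exprMn mulrCA.
Qed.

Lemma pintegral_ring_pown a b k : (0 < k)%N ->
  \I (fun z => ring_indicator a b z * z^-1 ^+ k) = 0.
Proof.
move=> k0; apply: (@pintegral_rot_eigen _ (unit345 ^+ k)^-1).
- by apply: tameM; [exact: tame_ring_indicator|apply: tameX; exact: tame_inv].
- by rewrite invr_eq1 unit345X_neq1.
- by move=> z; rewrite ring_indicator_rot invfM exprMn mulrCA -[in RHS]exprVn.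
Qed.
End AnnulusIntegral.

(** * Cauchy transforms of monomials on rings *)

Section CauchyTransform.
Local Open Scope classical_set_scope.
Local Open Scope complex_scope.
Import ComplexField.Normc.
Context {R : realType}.
Implicit Types (f g : R[i] -> R[i]) (z : R[i]).
Notation lam := (@lebesgue_measure R).
Notation plane := (measurableTypeR R * measurableTypeR R)%type.
Notation mu := (lam \x lam)%E.
Notation T := (@to_complex R @^-1` annulus).
Notation "\I g" := (planar_integral annulus g) (at level 10, g at level 8).

(** The ring contains the square of side h = (b - a) / 2 whose lower left corner is the real point
    [a]: there the modulus lies between the real part, at least [a], and the sum of both parts, at
    most a + 2h = b. *)
Lemma ring_area (a b : R) : 1 < a -> a < b -> b < 2 ->
  exists2 m : R, ((b - a) / 2) ^+ 2 <= m & \I (ring_indicator a b) = m%:C.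
Proof.
move=> a1 ab b2.
have mT := @measurable_annulus R.
have [i1 _] := tame_integrable (@tame_ring_indicator R a b).
rewrite /planar_integral /planar_lebesgue.
set m := Rintegral _ _ _; set im := Rintegral _ _ _.
have -> : im = 0.
  by rewrite /im /Rintegral integral0_eq.
exists m => //.
pose h := (b - a) / 2; have h0 : 0 < h by rewrite /h; lra.
have bE : b = a + h + h by rewrite /h; field.
pose Q : set plane := `[a, a + h]%classic `*` `[0, h]%classic.
have mI (x y : R) : measurable (`[x, y]%classic : set (measurableTypeR R)).
  exact: measurable_itv.
have mQ : measurable Q by exact: measurableX.
have QT p : Q p -> a <= cmod (to_complex p) <= b.
  move=> Qp; have [/andP[x1 x2] /andP[y1 y2]] :
    (a <= p.1 <= a + h) /\ (0 <= p.2 <= h).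
    by move: Qp => []; rewrite /= !in_itv.
  have := Re_le_cmod (to_complex p); have := cmod_le_ReIm (to_complex p).
  rewrite [complex.Re _]/= [complex.Im _]/= bE !ger0_norm//; last by lra.
  move=> c1 c2; apply/andP; split; lra.
have sQT : Q `<=` T.
  by move=> p /QT/andP[p1 p2]; apply/annulusP; apply/andP; split; lra.
have muQ : mu Q = (h ^+ 2)%:E.
  rewrite product_measure1E//= !lebesgue_measure_itv /= !lte_fin h0 ltrDl h0.
  by rewrite -!EFinB -EFinM; congr EFin; ring.
have <- : Rintegral mu T (\1_Q) = h ^+ 2.
  transitivity (fine (mu Q)); last by rewrite muQ.
  by rewrite /Rintegral integral_indic// (setIidl sQT).
rewrite /m; apply: le_Rintegral => //.
  apply: measurable_bounded_integrable => //;
    [exact: annulus_finite|exact: measurable_indic|].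
  exists 1; split; rewrite ?num_real// => M M1 p _ /=.
  by rewrite ger0_norm//; apply: le_trans (ltW M1); case: (p \in Q).
move=> p Tp /=; case: (boolP (p \in Q)) => [|_] /=.
  by rewrite inE => /QT ->.
by case: (_ <= _ <= _).
Qed.

Lemma bernoulli (x : R) n : 0 <= x -> 1 + n%:R * x <= (1 + x) ^+ n.
Proof.
move=> x0; elim: n => [|n IH]; first by rewrite mul0r addr0 expr0.
have h : 0 <= 1 + x by lra.
rewrite exprS; apply: le_trans (ler_wpM2l h IH).
rewrite -[n.+1]addn1 natrD; have : 0 <=
  n%:R * x ^+ 2 by rewrite mulr_ge0// sqr_ge0.
by rewrite expr2; nra.
Qed.

Lemma geometric_small (a x B : R) : 1 < a -> (forall M, x * a ^+ M <= B) -> x <=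
  0.
Proof.
move=> a1 H; rewrite leNgt; apply/negP => x0.
have d0 : 0 < x * (a - 1) by rewrite mulr_gt0// subr_gt0.
pose M := (Num.truncn (B / (x * (a - 1)))).+1.
have BM : B < M%:R * (x * (a - 1)).
  by rewrite -ltr_pdivrMr// /M; exact: truncnS_gt.
have := H M; have := @bernoulli (a - 1) M;
  rewrite subr_ge0 (ltW a1) [1 + (a - 1)]addrC subrK => /(_ isT).
move=> h1 h2; have := ler_wpM2l (ltW x0) h1; lra.
Qed.

Lemma ring_indicator_cases (a b : R) z w : 1 < a -> cmod z <= 1 -> annulus w ->
  ring_indicator a b w = 0 \/
  [/\ ring_indicator a b w = 1, a <= cmod w, cmod w <= 2 & z != w /\ w != 0].
Proof.
move=> a1 z1 /annulusP/andP[_ w2]; rewrite /ring_indicator;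
  case: (boolP (_ <= _ <= _)) => [/andP[w1 _]|_]; last by left.
right; split=> //; first exact: ltW.
split; apply/eqP => zw; first by move: w1; rewrite -zw; lra.
by move: w1; rewrite zw normc0; lra.
Qed.

(* The remainder after [M] terms of the expansion of [w ^+ n.+1 / (z - w)] in
   powers of [z / w], cut off to a ring. *)
Definition ring_kernel (a b : R) n z M w : R[i] :=
  ring_indicator a b w * w ^+ n.+1 * (z / w) ^+ M / (z - w).

(** On the ring [w] has modulus between [a] and 2, so z - w has modulus at least a - 1 and z / w at
    most 1 / a. *)
Lemma ring_kernel_bound (a b : R) n z M w : 1 < a -> cmod z <= 1 -> annulus w ->
  cmod (ring_kernel a b n z M w) <= 2 ^+ n.+1 / (a - 1) * a^-1 ^+ M.
Proof.
move=> a1 z1 aw; have a0 : 0 < a by lra.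
have [w0|[w1 wa w2 [zw wn0]]] := ring_indicator_cases b a1 z1 aw;
  rewrite /ring_kernel.
  rewrite w0 !mul0r normc0 mulr_ge0 ?divr_ge0 ?exprn_ge0 ?invr_ge0//; lra.
rewrite w1 mul1r !normcM !normcV !cmodX normcM normcV mulrAC -!mulrA.
apply: ler_pM; rewrite ?exprn_ge0 ?cmod_ge0//.
- by rewrite mulr_ge0 ?invr_ge0 ?cmod_ge0 ?exprn_ge0 ?mulr_ge0 ?invr_ge0
  ?cmod_ge0.
- by apply: lerXn2r; rewrite ?nnegrE ?cmod_ge0.
apply: ler_pM; rewrite ?invr_ge0 ?exprn_ge0 ?cmod_ge0// ?mulr_ge0 ?invr_ge0
  ?cmod_ge0//.
  rewrite lef_pV2 ?posrE; last 2 first.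
  - by apply: lt_le_trans (cmodB_ge _ _); lra.
  - lra.
  by have := cmodB_ge z w; lra.
apply: lerXn2r; rewrite ?nnegrE ?mulr_ge0 ?invr_ge0 ?cmod_ge0// ?(ltW a0)//.
rewrite -[leRHS]mul1r; apply: ler_pM; rewrite ?invr_ge0 ?cmod_ge0//.
by rewrite lef_pV2 ?posrE//; apply: lt_le_trans wa.
Qed.

Lemma tame_ring_kernel (a b : R) n z M : 1 < a -> cmod z <= 1 ->
  tame (ring_kernel a b n z M).
Proof.
move=> a1 z1; split; last by eexists => w; exact: ring_kernel_bound.
have mR := @planar_measurable_ring_indicator R a b.
have mi := @planar_measurable_id R.
have mN : planar_measurable (fun w : R[i] => - w).
  have := planar_measurableM (planar_measurable_cst (-1)) mi.
  by congr (planar_measurable _); apply/funext => w; rewrite mulN1r.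
apply: planar_measurableM; last first.
  apply: planar_measurableV; apply: planar_measurableD;
    first exact: planar_measurable_cst.
  exact: mN.
apply: planar_measurableM; first by apply: planar_measurableM => //;
  exact: planar_measurableX.
apply: planar_measurableX; apply: planar_measurableM;
  first exact: planar_measurable_cst.
exact: planar_measurableV.
Qed.

(** Expanding the kernel in powers of z / w turns the integrand into multiples of w^(n - M); only M
    = n contributes, and the remainder tends to 0. *)
Lemma cauchy_ring_pow (a b : R) n z : 1 < a -> cmod z <= 1 ->
  \I (fun w => ring_indicator a b w * w ^+ n.+1 / (z - w)) =
    - z ^+ n * \I (ring_indicator a b).
Proof.
move=> a1 z1; have a0 : 0 < a by lra.
pose E := ring_kernel a b n z.
have ringC w (aw : annulus w) := ring_indicator_cases b a1 z1 aw.
have tE M : tame (E M) := tame_ring_kernel b n M a1 z1.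
have tR : tame (ring_indicator a b) := tame_ring_indicator a b.
pose G M w := ring_indicator a b w * w ^+ n.+1 * w^-1 ^+ M.+1.
have tG M : tame (G M).
  by apply: tameM; [apply: tameM => //; apply: tameX;
    exact: tame_id|apply: tameX; exact: tame_inv].
(* This integrates 1 / (z - w) = - 1 / w + (z / w) / (z - w), multiplied by the other factors of
   [E M]. *)
have step M : \I (E M) = - z ^+ M * \I (G M) + \I (E M.+1).
  rewrite -pintegralZ// -pintegralD//; last first.
    by apply: tameM => //; exact: tame_cst.
  apply: eq_pintegral => w aw; rewrite /E /G /ring_kernel.
  have [->|[-> wa w2 [zw wn0]]] := ringC w aw;
    first by rewrite !mul0r mulr0 addr0.
  have zw0 : z - w != 0 by rewrite subr_eq0.
  rewrite !mul1r (exprSr (z / w)) (exprSr w^-1) !expr_div_n exprVn.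
  have := expf_neq0 M wn0; move: (w ^+ n.+1) (w ^+ M) (z ^+ M) => W P Z P0.
  by field; rewrite zw0 wn0 P0.
have G0 M : M != n -> \I (G M) = 0.
  rewrite neq_ltn => /orP[Mn|nM].
    rewrite -(@pintegral_ring_pow R a b (n - M)) ?subn_gt0//.
    apply: eq_pintegral => w aw; rewrite /G.
    have [->|[-> wa w2 [zw wn0]]] := ringC w aw; first by rewrite !mul0r.
    rewrite !mul1r (_ : n.+1 = (n - M) + M.+1)%N; last by lia.
    by rewrite exprD exprVn mulfK ?expf_neq0.
  rewrite -(@pintegral_ring_pown R a b (M - n)) ?subn_gt0//.
  apply: eq_pintegral => w aw; rewrite /G.
  have [->|[-> wa w2 [zw wn0]]] := ringC w aw; first by rewrite !mul0r.
  rewrite !mul1r (_ : M.+1 = n.+1 + (M - n))%N; last by lia.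
  by rewrite exprD !exprVn mulrA divff ?mul1r ?expf_neq0.
have Gn : \I (G n) = \I (ring_indicator a b).
  apply: eq_pintegral => w aw; rewrite /G.
  have [->|[-> wa w2 [zw wn0]]] := ringC w aw; first by rewrite !mul0r.
  by rewrite mul1r exprVn divff ?expf_neq0.
have E0 M : (M <= n)%N -> \I (E 0%N) = \I (E M).
  elim: M => // M IH Mn; rewrite IH ?(ltnW Mn)// step G0 ?mulr0 ?add0r//.
  by rewrite neq_ltn Mn.
have En M : (n < M)%N -> \I (E n.+1) = \I (E M).
  elim: M => // M IH; rewrite ltnS leq_eqVlt => /orP[/eqP <- //|nM].
  by rewrite IH// step G0 ?mulr0 ?add0r// neq_ltn nM orbT.
(* Beyond the index [n] the integral of the remainder is constant, yet it is bounded by a multiple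
   of a^(- M) for arbitrarily large M. *)
have EN0 : \I (E n.+1) = 0.
  have [C HC] := @pintegral_bound R.
  apply: eq0_normc; apply/eqP; rewrite eq_le cmod_ge0 andbT.
  apply: (@geometric_small a _ (`|C| * (2 ^+ n.+1 / (a - 1)))) => // M.
  have h : cmod (\I (E n.+1)) <= `|C| * (2 ^+ n.+1 / (a - 1)) / a ^+ (n.+1 + M).
    rewrite (En (n.+1 + M)%N) ?leq_addr//;
      apply: le_trans
      (HC _ _ (tE _) (fun w aw => ring_kernel_bound b n _ a1 z1 aw)) _.
    rewrite -exprVn -!mulrA; apply: ler_wpM2r; last exact: ler_norm.
    by rewrite mulr_ge0 ?mulr_ge0 ?exprn_ge0 ?invr_ge0//; lra.
  have aM : 0 < a ^+ (n.+1 + M) by rewrite exprn_gt0.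
  move: h; rewrite ler_pdivlMr//; apply: le_trans.
  by rewrite ler_wpM2l ?cmod_ge0// ler_eXn2l ?leq_addl.
transitivity (\I (E 0%N)).
  by apply: eq_pintegral => w _; rewrite /E /ring_kernel expr0 mulr1.
by rewrite (E0 n)// step Gn EN0 addr0.
Qed.
End CauchyTransform.

(** * Polynomials with rapidly decaying coefficients *)

Section ClassMembership.
Local Open Scope classical_set_scope.
Local Open Scope complex_scope.
Import numFieldNormedType.Exports ComplexField.Normc.
Context {R : realType}.
Implicit Types (f g : R[i] -> R[i]) (z : R[i]).
Notation "\I g" := (planar_integral annulus g) (at level 10, g at level 8).

Lemma derivable_horner_complex (p : {poly R[i]}) (z : R[i]^o) :
  derivable (horner p : R[i]^o -> R[i]^o) z 1.
Proof.
elim/poly_ind: p => [|p r ih].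
  rewrite (_ : horner 0 = cst 0); first exact: derivable_cst.
  by apply/funext => y; rewrite horner0.
rewrite (_ : horner _ = (horner p * id + cst r)).
  apply: derivableD; last exact: derivable_cst.
  by apply: derivableM; [exact: ih|exact: derivable_id].
by apply/funext => y; rewrite !hornerE.
Qed.

Lemma analytic_on_disc_poly f (p : {poly R[i]}) :
  (forall z, cmod z < 1 -> f z = p.[z]) -> analytic_on (disc 1) f.
Proof.
move=> fp z z1; have z1' : cmod z < 1 := z1.
apply: (@near_eq_derivable _ R[i]^o R[i]^o (horner p));
  last exact: derivable_horner_complex.
have e0 : 0 < (1 - cmod z)%:C by rewrite ltcR subr_gt0.
apply/nbhs_normP; exists (1 - cmod z)%:C => //= y /=.
rewrite -(opprB y) normrN => yz; rewrite fp//.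
have yz' : cmod (y - z) < 1 - cmod z.
  by move: yz; rewrite -ltcR; apply: le_lt_trans.
have := cmodD z (y - z); rewrite addrC subrK; lra.
Qed.

(** Telescoping sum. These weights make the bound on the density of a polynomial independent of its
    degree. *)
Lemma sum_inv_succ2_le1 n :
  \sum_(k < n) ((k.+1%:R * k.+2%:R)^-1 : R) <= 1.
Proof.
suff -> : \sum_(k < n) ((k.+1%:R * k.+2%:R)^-1 : R) = 1 - n.+1%:R^-1.
  by rewrite gerBl invr_ge0.
elim: n => [|n IH]; first by rewrite big_ord0 invr1 subrr.
rewrite big_ord_recr /= IH.
rewrite -[n.+2%:R]natr1; have := ltr0Sn R n; move: n.+1%:R => u u0.
by field; rewrite !gt_eqF//; lra.
Qed.

Lemma powX_le_expR (x : R) n : 0 <= x -> x ^+ n <= expR (n%:R * x).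
Proof.
move=> x0; rewrite expRM_natl; apply: lerXn2r; rewrite ?nnegrE ?expR_ge0//.
by apply: le_trans (expR_ge1Dx x); lra.
Qed.

(** Here [x] is the coefficient of z^n and [t] the distance from the unit circle. The second factor
    on the left bounds pi over the area of the ring from 1 + eta / s to 1 + 2 eta / s, the third
    bounds |w|^(n + 1) on it. Since 6 eta <= c, the exponent - c s + 2 eta s is at most - c s / 2 -
    eta s: the first half absorbs powers of [s], the rest gives the decay in [t]. *)
Lemma coef_decay (c eta x t : R) n : 0 < eta -> 6 * eta <= c ->
  `|x| <= expR (- (c * Num.sqrt n%:R)) ->
  let s := Num.sqrt n.+1%:R in eta / s <= t ->
  `|x| * (4 * pi * s ^+ 2 / eta ^+ 2) * (1 + 2 * (eta / s)) ^+ n.+1 <=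
  (expR c * (8 * pi / eta ^+ 2) * (12 / c) ^+ 6) * (n.+1%:R * n.+2%:R)^-1 *
    expR (- (eta ^+ 2 / t)).
Proof.
move=> e0 ec hx s ht.
have c0 : 0 < c by lra.
have s1 : 1 <= s by rewrite -[leLHS]sqrtr1 ler_wsqrtr// ler1n.
have s0 : 0 < s by lra.
have s2 : s ^+ 2 = n.+1%:R by rewrite sqr_sqrtr.
have sn : s <= Num.sqrt n%:R + 1.
  rewrite -[leRHS]ger0_norm ?addr_ge0 ?sqrtr_ge0// -sqrtr_sqr ler_wsqrtr//.
  rewrite sqrrD sqr_sqrtr// -natr1 expr1n lerD2r lerDl mulr1.
  by rewrite mulrn_wge0 ?sqrtr_ge0.
have t0 : 0 < t by apply: lt_le_trans ht; rewrite divr_gt0.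
have pi0 : 0 < pi :> R := pi_gt0 R.
(* Passing from sqrt n to [s] changes the root by at most 1, which costs the factor [expR c]. *)
have h1 : `|x| <= expR c * expR (- (c * s)).
  by apply: le_trans hx _; rewrite -expRD ler_expR; nra.
have h2 : (1 + 2 * (eta / s)) ^+ n.+1 <= expR (2 * eta * s).
  apply: (@le_trans _ _ (expR (2 * (eta / s)) ^+ n.+1)).
    apply: lerXn2r; rewrite ?nnegrE ?expR_ge0 ?expR_ge1Dx//.
    by rewrite addr_ge0 ?mulr_ge0 ?invr_ge0 ?(ltW e0) ?(ltW s0).
  rewrite -expRM_natl ler_expR -s2 le_eqVlt; apply/orP; left; apply/eqP; field.
  by rewrite gt_eqF.
have h3 : expR (- (eta * s)) <= expR (- (eta ^+ 2 / t)).
  rewrite ler_expR lerN2 ler_pdivrMr//.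
  move: ht; rewrite ler_pdivrMr// => ht;
    rewrite expr2 -mulrA ler_pM2l// [s * t]mulrC//.
(* This is y^6 <= exp (6 y) at y = c s / 12. Of the sixth power, s^2 pays for the ring area and s^4
   for the summable weight. *)
have h4 : s ^+ 6 * expR (- (c * s / 2)) <= (12 / c) ^+ 6.
  rewrite expRN ler_pdivrMr ?expR_gt0//.
  have := @powX_le_expR (c * s / 12) 6;
    rewrite (_ : 6%:R * (c * s / 12) = c * s / 2); last by field.
  have cs : 0 <= c * s / 12 by rewrite divr_ge0// mulr_ge0// ltW.
  move=> /(_ cs) h.
  apply: le_trans (ler_wpM2l _ h); last by rewrite exprn_ge0 ?divr_ge0// ltW.
  rewrite -exprMn (_ : 12 / c * (c * s / 12) = s)//; field; by rewrite gt_eqF.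
have h5 : s ^+ 2 * (s ^+ 6)^-1 <= 2 * (n.+1%:R * n.+2%:R)^-1.
  rewrite (_ : s ^+ 2 * (s ^+ 6)^-1 = ((s ^+ 2) * (s ^+ 2))^-1); last first.
    by field; rewrite gt_eqF.
  have : 1 <= s ^+ 2 by rewrite s2 ler1n.
  rewrite -[n.+2%:R]natr1 -s2; move: (s ^+ 2) => u u1.
  by rewrite ler_pdivlMr ?mulr_gt0 1?mulrC ?ler_pdivrMr ?mulr_gt0//; nra.
have h6 : expR (- (c * s)) * expR (2 * eta * s) <=
  expR (- (c * s / 2)) * expR (- (eta * s)).
  by rewrite -!expRD ler_expR; nra.
have E0 := expR_gt0.
set k := 4 * pi / eta ^+ 2.
have k0 : 0 < k by rewrite divr_gt0 ?mulr_gt0 ?exprn_gt0.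
apply: (@le_trans _ _ ((expR c * expR (- (c * s))) * (k * s ^+ 2) * expR
  (2 * eta * s))).
  apply: ler_pM => //.
  - by rewrite mulr_ge0// divr_ge0 ?mulr_ge0 ?exprn_ge0 ?(ltW pi0) ?(ltW s0)
    ?(ltW e0).
  - by rewrite exprn_ge0// addr_ge0 ?mulr_ge0 ?invr_ge0 ?(ltW e0) ?(ltW s0).
  rewrite (_ : 4 * pi * s ^+ 2 / eta ^+ 2 = k * s ^+ 2); last by rewrite /k;
    ring.
  by apply: ler_wpM2r => //; rewrite mulr_ge0 ?exprn_ge0 ?(ltW k0)// ltW.
rewrite (_ : _ * _ * _ * _ = expR c * k * s ^+ 2
  * (expR (- (c * s)) * expR (2 * eta * s))); last by ring.
have g0 : 0 <= expR c * k * s ^+ 2 by rewrite mulr_ge0 ?sqr_ge0// mulr_ge0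
  ?expR_ge0 ?(ltW k0).
apply: le_trans (ler_wpM2l g0 h6) _.
rewrite (_ : expR c * (8 * pi / eta ^+ 2) = expR c * k * 2); last by rewrite /k;
  ring.
have s6 : 0 < s ^+ 6 by rewrite exprn_gt0.
rewrite [leLHS](_ : _ = expR c * k * (s ^+ 2 * (s ^+ 6)^-1)
  * (s ^+ 6 * expR (- (c * s / 2))) * expR (- (eta * s))); last first.
  by field; rewrite gt_eqF.
have p6 : 0 <= (12 / c) ^+ 6 by rewrite exprn_ge0// divr_ge0// ltW.
have w0 : 0 <= ((n.+1%:R * n.+2%:R)^-1 : R) by rewrite invr_ge0 mulr_ge0.
have ck : 0 <= expR c * k by rewrite mulr_ge0 ?expR_ge0 ?ltW.
have q0 : 0 <= s ^+ 2 * (s ^+ 6)^-1 by rewrite mulr_ge0 ?invr_ge0 ?exprn_ge0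
  ?ltW.
have r0 : 0 <= s ^+ 6 * expR (- (c * s / 2)) by rewrite mulr_ge0 ?expR_ge0 ?ltW.
rewrite [leRHS](_ : _ = expR c * k * (2 * (n.+1%:R * n.+2%:R)^-1) * (12 / c) ^+
  6 * expR (- (eta ^+ 2 / t))); last by ring.
apply: ler_pM; rewrite ?expR_ge0//; first by rewrite mulr_ge0// mulr_ge0.
apply: ler_pM => //; first by rewrite mulr_ge0.
exact: ler_wpM2l.
Qed.

Lemma poly_classC0 (c : R) : 0 < c -> exists d d' : R, [/\ 0 < d, 0 < d' &
  forall p : {poly R}, (forall n, `|p`_n| <= expR (- (c * Num.sqrt n%:R))) ->
  exists2 f : R[i] -> R[i], classC0 d d' f &
    forall z, cmod z <= 1 -> f z = (map_poly (real_complex R) p).[z]].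
Proof.
(* The bound 1/4 keeps the rings inside radius 3/2; the bound c / 6 is the condition of
   [coef_decay]. *)
move=> c0; pose eta := Num.min 4^-1 (c / 6).
have e0 : 0 < eta by rewrite lt_min invr_gt0 divr_gt0// ltr0n.
have e4 : eta <= 4^-1 by rewrite ge_min lexx.
have e6 : 6 * eta <= c.
  by have : eta <= c / 6 by [rewrite ge_min lexx orbT]; lra.
have pi0 : 0 < pi :> R := pi_gt0 R.
pose D := expR c * (8 * pi / eta ^+ 2) * (12 / c) ^+ 6.
have D0 : 0 < D.
  by rewrite /D !mulr_gt0 ?expR_gt0 ?exprn_gt0 ?invr_gt0 ?mulr_gt0 ?exprn_gt0.
(* With d = eta^(-2) the required exponent - 1 / (d t) is the - eta^2 / t of [coef_decay]. *)
exists (eta ^- 2), D; split=> //; first by rewrite invr_gt0 exprn_gt0.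
move=> p pc.
pose s n : R := Num.sqrt n.+1%:R.
have s1 n : 1 <= s n by rewrite -[leLHS]sqrtr1 ler_wsqrtr// ler1n.
pose tau n := eta / s n.
have tau0 n : 0 < tau n by rewrite divr_gt0//; have := s1 n; lra.
have tau4 n : tau n <= 4^-1.
  by rewrite ler_pdivrMr; have := s1 n; [nra|lra].
pose A n := ring_indicator (1 + tau n) (1 + 2 * tau n) : R[i] -> R[i].
have areaE n : {m : R | (tau n / 2) ^+ 2 <= m & \I (A n) = m%:C}.
  apply: cid2; have t0 := tau0 n; have t4 := tau4 n.
  have [] := @ring_area R (1 + tau n) (1 + 2 * tau n); [lra|lra|lra|].
  by move=> m h1 h2; exists m => //; move: h1; congr (_ ^+ 2 <= _); field.
pose m n := s2val (areaE n).
have mE n : \I (A n) = (m n)%:C := s2valP' (areaE n).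
have m_ge n : (tau n / 2) ^+ 2 <= m n := s2valP (areaE n).
have m0 n : 0 < m n by apply: lt_le_trans (m_ge n);
  rewrite exprn_gt0// divr_gt0.
(* The sign, pi and the area [m n] cancel those produced by [cauchy_transform] and
   [cauchy_ring_pow]. *)
pose k n : R := - (p`_n * (pi / m n)).
pose term n w : R[i] := (k n)%:C * (A n w * w ^+ n.+1).
pose phi w : R[i] := \sum_(n < size p) term n w.
have pm_term n : planar_measurable (term n).
  apply: planar_measurableM; first exact: planar_measurable_cst.
  apply: planar_measurableM; first exact: planar_measurable_ring_indicator.
  exact/planar_measurableX/planar_measurable_id.
have term_le n w : 1 < cmod w -> cmod (term n w) <=
    D * (n.+1%:R * n.+2%:R)^-1 * expR (- (eta ^- 2 * (cmod w - 1))^-1).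
  move=> w1; rewrite /term /A /ring_indicator.
  case: (boolP (_ <= cmod w <= _)) => [/andP[wl wu]|_]; last first.
    rewrite mul0r mulr0 normc0; apply: mulr_ge0; last exact: expR_ge0.
    by apply: mulr_ge0; [exact: ltW|rewrite invr_ge0 mulr_ge0].
  rewrite mul1r normcM cmodX cmod_real /k normrN normrM.
  have ht : eta / s n <= cmod w - 1 by rewrite -/(tau n); lra.
  rewrite [(eta ^- 2 * _)^-1]invfM invrK;
    apply: le_trans (coef_decay e0 e6 (pc n) ht).
  apply: ler_pM; rewrite ?exprn_ge0 ?cmod_ge0// ?mulr_ge0//.
    apply: ler_wpM2l => //; rewrite ger0_norm ?divr_ge0 ?(ltW pi0)
      ?(ltW (m0 n))//.
    rewrite ler_pdivrMr// -/(s n); have := m_ge n.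
    have sn0 : 0 < s n by have := s1 n; lra.
    have kk : 0 < 4 * pi * s n ^+ 2 / eta ^+ 2 by rewrite divr_gt0 ?mulr_gt0
      ?exprn_gt0.
    move=> /(ler_wpM2l (ltW kk)); apply: le_trans.
    rewrite le_eqVlt; apply/orP; left; apply/eqP; rewrite /tau; field.
    by rewrite !gt_eqF.
  by apply: lerXn2r => //; rewrite nnegrE ?cmod_ge0//; have := tau0 n;
    rewrite /tau; lra.
have fE z : cmod z <= 1 -> cauchy_transform phi z =
  (map_poly (real_complex R) p).[z].
  move=> z1; rewrite /cauchy_transform.
  pose K n w : R[i] := A n w * w ^+ n.+1 / (z - w).
  have a1 n : 1 < 1 + tau n by have := tau0 n; lra.
  have tK n : tame (K n).
    have := tame_ring_kernel (1 + 2 * tau n) n 0 (a1 n) z1.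
    by congr tame; apply/funext => w; rewrite /ring_kernel expr0 mulr1.
  transitivity ((pi^-1)%:C * \I (fun w => \sum_(n < size p) (k n)%:C * K n w)).
    congr (_ * _); apply: eq_pintegral => w _.
    by rewrite /phi mulr_suml; apply: eq_bigr => n _; rewrite /term /K !mulrA.
  rewrite pintegral_sum; last by move=> n; apply: tameM => //; exact: tame_cst.
  rewrite mulr_sumr horner_poly; apply: eq_bigr => n _.
  rewrite pintegralZ// cauchy_ring_pow// mE /k -/(A n).
  have -> : (- (p`_n * (pi / m n)))%:C = - ((p`_n)%:C * (pi%:C / (m n)%:C)).
    by rewrite rmorphN rmorphM fmorph_div.
  have piC : pi%:C != 0 :> R[i] by rewrite fmorph_eq0 gt_eqF.
  have mC : (m n)%:C != 0 :> R[i] by rewrite fmorph_eq0 gt_eqF.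
  rewrite fmorphV /=; move: (p`_n)%:C pi%:C (m n)%:C (z ^+ n) piC mC =>
    x y v w y0 v0.
  by field; rewrite y0 v0.
exists (cauchy_transform phi).
  split; last first.
    exists phi; split => //.
    - by apply: planar_measurable_sum.
    - move=> z zA; rewrite /phi big1// => n _; rewrite /term /A /ring_indicator.
      case: (boolP (_ <= cmod z <= _)) => [/andP[z1 z2]|_];
        last by rewrite mul0r mulr0.
      exfalso; apply: zA; apply/annulusP; have := tau0 n; have := tau4 n.
      by move=> t4 t0; apply/andP; split; lra.
    - move=> z /andP[z1 z2]; apply: le_trans (cmod_sum _ _ _) _.
      apply: (@le_trans _ _ (\sum_(n < size p) D * (n.+1%:R * n.+2%:R)^-1 *
          expR (- (eta ^- 2 * (cmod z - 1))^-1))).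
        by apply: ler_sum => n _; exact: term_le.
      rewrite -mulr_suml -mulr_sumr ler_wpM2r ?expR_ge0//.
      by rewrite ger_pMr// sum_inv_succ2_le1.
  by apply: (@analytic_on_disc_poly _ (map_poly (real_complex R) p)) => z /ltW;
    exact: fE.
exact: fE.
Qed.
End ClassMembership.

(** * Polynomials with prescribed support and many zeros *)

(** The sum is the coefficient of degree [(size s).-1] of the Lagrange interpolant of X^i at the
    nodes. By uniqueness the interpolant is X^i itself, whose degree is smaller. *)
Lemma divided_difference_pow (F : fieldType) (s : seq nat) (x : nat -> F) i :
  uniq s -> {in s &, injective x} -> (i < (size s).-1)%N ->
  \sum_(j <- s) x j ^+ i / \prod_(k <- s | k != j) (x j - x k) = 0.
Proof.
move=> us xinj iN.
pose P j : {poly F} := \prod_(k <- s | k != j) ('X - (x k)%:P).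
pose c j : F := x j ^+ i / \prod_(k <- s | k != j) (x j - x k).
pose L : {poly F} := \sum_(j <- s) c j *: P j.
have PE j : P j = \prod_(y <- map x (rem j s)) ('X - y%:P).
  by rewrite big_map rem_filter// big_filter.
have sP j : j \in s -> size (P j) = size s.
  move=> js; rewrite PE size_prod_XsubC size_map size_rem// prednK//.
  by case: (s) js.
have Px j m : (P j).[x m] = \prod_(k <- s | k != j) (x m - x k).
  by rewrite /P horner_prod; apply: eq_bigr => k _; rewrite hornerXsubC.
have Pd j : j \in s -> \prod_(k <- s | k != j) (x j - x k) != 0.
  move=> js; rewrite prodf_seq_neq0; apply/allP => k ks; apply/implyP => kj.
  by rewrite subr_eq0; apply: contra kj => /eqP /xinj ->.
have Lx m : m \in s -> L.[x m] = x m ^+ i.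
  move=> ms; rewrite /L horner_sum (bigD1_seq m)//= [X in _ + X]big1_seq ?addr0.
    by rewrite hornerZ Px /c divfK// Pd.
  move=> j /andP[jm js]; rewrite hornerZ Px.
  rewrite [X in _ * X](_ : _ = 0) ?mulr0//; apply/eqP; rewrite prodf_seq_eq0.
  by apply/hasP; exists m; rewrite ?subrr ?eqxx// andbT eq_sym.
have sL : (size L <= size s)%N.
  rewrite /L; apply: (leq_trans (size_sum _ _ _));
    apply/bigmax_leqP_seq => j js _.
  by apply: (leq_trans (size_scale_leq _ _)); rewrite sP.
have LE : L = 'X^i.
  apply/eqP; rewrite -subr_eq0; apply/eqP.
  apply: (@roots_geq_poly_eq0 _ _ (map x s)).
  - apply/allP => _ /mapP[m ms ->]; by rewrite /root !hornerE Lx// subrr.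
  - by rewrite map_inj_in_uniq.
  rewrite size_map; apply: (leq_trans (size_polyD _ _));
    rewrite size_polyN geq_max sL.
  by rewrite size_polyXn; apply: leq_trans iN _; exact: leq_pred.
have := congr1 (fun p : {poly F} => p`_(size s).-1) LE.
rewrite coefXn gtn_eqF// mulr0n => L0; rewrite -[RHS]L0 /L coef_sum;
  apply: eq_big_seq => j js.
rewrite coefZ; have : lead_coef (P j) = 1.
  by apply/eqP; rewrite -monicE PE monic_prod_XsubC.
by rewrite /lead_coef sP// => ->; rewrite mulr1.
Qed.

Section VanishingPolynomial.
Context {R : realType}.

Lemma bernoulli_sub (x : R) n : 0 <= x <= 1 -> 1 - n%:R * x <= (1 - x) ^+ n.
Proof.
move=> /andP[x0 x1]; elim: n => [|n IH]; first by rewrite mul0r subr0 expr0.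
have h : 0 <= 1 - x by lra.
rewrite exprS; apply: le_trans (ler_wpM2l h IH).
rewrite -natr1; have : 0 <= n%:R * x ^+ 2 by rewrite mulr_ge0// sqr_ge0.
by rewrite expr2; nra.
Qed.

(** In 1 - q^c = (1 - q)(1 + q + ... + q^(c - 1)) each of the [c] summands is at least q^c. *)
Lemma one_subX_ge (q : R) c : 0 <= q <= 1 -> c%:R * (1 - q) * q ^+ c <=
  1 - q ^+ c.
Proof.
move=> /andP[q0 q1]; elim: c => [|c IH]; first by rewrite !mul0r expr0 subrr.
have qc0 : 0 <= q ^+ c by rewrite exprn_ge0.
have qc1 : q ^+ c <= 1 by rewrite exprn_ile1.
rewrite exprS -natr1.
have : c%:R * (1 - q) * q ^+ c * q <= (1 - q ^+ c) * q by rewrite ler_wpM2r.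
have : (1 - q) * (q * q ^+ c) <= 1 - q.
  by rewrite -[leRHS]mulr1 ler_wpM2l ?subr_ge0// mulr_ile1.
move: (q ^+ c) c%:R => Q C; lra.
Qed.

Lemma expr_dist_ge (q : R) D x k : 0 <= q <= 1 -> (x <= D)%N -> (k <= D)%N ->
  q ^+ D * (`|x%:R - k%:R| * (1 - q)) <= `|q ^+ x - q ^+ k|.
Proof.
move=> q01; wlog xk : x k / (x <= k)%N.
  move=> W xD kD; case: (leqP x k) => [xk|/ltnW kx]; first exact: W.
  by rewrite distrC [leRHS]distrC; exact: W.
move=> _ kD; have /andP[q0 q1] := q01.
rewrite -[in leRHS](subnKC xk) exprD.
rewrite (_ : q ^+ x - q ^+ x * q ^+ (k - x) = q ^+ x * (1 - q ^+ (k - x)));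
  last by ring.
rewrite [leRHS]ger0_norm; last by rewrite mulr_ge0 ?exprn_ge0// subr_ge0
  exprn_ile1.
rewrite distrC ger0_norm ?subr_ge0 ?ler_nat// -natrB//.
apply: le_trans (ler_wpM2l (exprn_ge0 x q0) (one_subX_ge (k - x) q01)).
rewrite mulrA [X in _ <= X](_ : _ = q ^+ k * ((k - x)%:R * (1 - q)));
  last first.
  by rewrite -[q ^+ k](_ : q ^+ x * q ^+ (k - x) = _);
    [ring|rewrite -exprD subnKC].
rewrite -mulrA; apply: ler_wpM2r; first by rewrite mulr_ge0// subr_ge0.
exact: ler_wiXn2l.
Qed.

Lemma prod_const_le (I : Type) (r : seq I) (P : pred I) (c : R) : 1 <= c ->
  \prod_(i <- r | P i) c <= c ^+ size r.
Proof.
move=> c1; have c0 : 0 <= c by apply: le_trans c1.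
elim: r => [|i r IH]; first by rewrite big_nil.
rewrite big_cons; case: ifP => _ /=; rewrite exprS; first exact: ler_wpM2l.
by apply: le_trans IH _; rewrite ler_peMl// exprn_ge0.
Qed.

(** The inverse of the limit of |p_x / p_0| as [q] tends to 1, for the divided difference at the
    powers of [q]. *)
Definition node_gap (t : seq nat) (x : nat) : R :=
  \prod_(y <- t | y != x) (`|x%:R - y%:R| / y%:R).

Lemma vanishing_poly (t : seq nat) : uniq t -> 0%N \notin t ->
  exists (p : {poly R}) (r : seq R),
    [/\ p`_0 = 1, forall n, n \notin 0%N :: t -> p`_n = 0,
        forall x, x \in t -> `|p`_x| <= 2 / node_gap t x,
        uniq r /\ size r = size t &
        forall y, y \in r -> 0 <= y <= 1 /\ root p y].
Proof.
move=> ut t0; pose s := 0%N :: t; pose N := size t.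
have us : uniq s by rewrite /= t0.
pose D := (\max_(y <- t) y).+1.
have yD y : y \in s -> (y <= D)%N.
  rewrite inE => /orP[/eqP ->//|yt]; apply: leqW.
  by apply: (leq_bigmax_seq (F := id)).
(* By Bernoulli's inequality this makes q^(D (N + 1)) at least 1/2. Replacing differences of powers
   by differences of exponents loses q^(- D) in each of at most N factors, hence at most 2 in
   all. *)
pose e : R := (2 * (D * N.+1)%:R)^-1.
have DN1 : 1 <= (D * N.+1)%:R :> R by rewrite ler1n muln_gt0.
have e0 : 0 < e by rewrite invr_gt0; lra.
have e1 : e <= 2^-1 by rewrite lef_pV2 ?posrE; lra.
pose q := 1 - e.
have q0 : 0 < q by rewrite /q; lra.
have q1 : q < 1 by rewrite /q; lra.
have q01 : 0 <= q <= 1 by rewrite !ltW.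
have qDN : 2^-1 <= q ^+ (D * N.+1).
  apply: le_trans (bernoulli_sub _ _); last by rewrite /= ltW//=; lra.
  by rewrite /e; move: (_%:R) DN1 => u u1; rewrite (_ : u * _ = 2^-1);
    [lra|field; rewrite gt_eqF//; lra].
have qinj : injective (fun i : nat => q ^+ i).
  by apply: ieexprIn => //; rewrite lt_eqF.
pose W j := \prod_(k <- s | k != j) (q ^+ j - q ^+ k).
have W0 j : W j != 0.
  rewrite prodf_seq_neq0; apply/allP => k ks; apply/implyP => kj.
  by rewrite subr_eq0; apply: contra kj => /eqP /qinj ->.
pose a j := W 0%N / W j.
pose p : {poly R} := \sum_(j <- s) a j *: 'X^j.
have pE n : p`_n = if n \in s then a n else 0.
  rewrite /p coef_sum; case: ifPn => ns.
    rewrite (bigD1_seq n)//= coefZ coefXn eqxx mulr1 big1 ?addr0// => j jn.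
    by rewrite coefZ coefXn eq_sym (negPf jn) mulr0.
  rewrite big1_seq// => j /andP[_ js]; rewrite coefZ coefXn.
  by rewrite (_ : n == j = false) ?mulr0//; apply: contraNF ns => /eqP ->.
exists p, [seq q ^+ i | i <- iota 0 N]; split.
- by rewrite pE inE eqxx /a divff.
- by move=> n ns; rewrite pE (negPf ns).
- move=> x xt; have xs : x \in s by rewrite inE xt orbT.
  have x0 : x != 0%N by apply: contraNneq t0 => <-.
  have x0' : (0%N == x) = false by rewrite eq_sym (negPf x0).
  have W0E : W 0%N = \prod_(k <- t) (1 - q ^+ k).
    rewrite /W /s big_cons eqxx /= [LHS]big_mkcond [RHS]big_mkcond /=.
    apply: eq_big_seq => k kt; rewrite expr0; case: eqP => // k0.
    by move: t0; rewrite -k0 kt.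
  (* The factor of the node 0 in [W x] cancels, up to sign, the factor of the node [x] in [W 0]. *)
  have WxE : W x = (q ^+ x - 1) * \prod_(k <- t | k != x) (q ^+ x - q ^+ k).
    by rewrite /W /s big_cons x0' expr0.
  have qx1 : q ^+ x - 1 != 0.
    by rewrite subr_eq0 lt_eqF// exprn_ilt1 ?(ltW q0)// lt0n.
  have aE : `|a x| = \prod_(k <- t | k != x)
    (`|1 - q ^+ k| / `|q ^+ x - q ^+ k|).
    rewrite /a W0E WxE (bigD1_seq x)//= !normrM normfV normrM
      -[X in `|X| * _]opprB normrN.
    rewrite invfM mulrACA divff ?mul1r ?normr_eq0//.
    by rewrite !normr_prod -prodfV -big_split.
  rewrite pE xs aE.
  have qD0 : 0 < q ^+ D by rewrite exprn_gt0.
  apply: (@le_trans _ _ (\prod_(k <- t | k != x)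
    ((q ^+ D)^-1 * (`|x%:R - k%:R| / k%:R)^-1))).
    rewrite big_seq_cond [leRHS]big_seq_cond; apply: ler_prod => k /andP[kt kx].
    have k0 : (0 < k)%N by rewrite lt0n; apply: contraNneq t0 => <-.
    have dk : 0 < `|x%:R - k%:R| :> R.
      by rewrite normr_gt0 subr_eq0 eqr_nat eq_sym.
    have ks : k \in s by rewrite inE kt orbT.
    have := expr_dist_ge q01 (yD x xs) (yD k ks).
    have g0 : 0 < q ^+ D * (`|x%:R - k%:R| * (1 - q)).
      by rewrite mulr_gt0// mulr_gt0// subr_gt0.
    move=> h; apply/andP; split; first by rewrite divr_ge0.
    rewrite -invfM ler_pdivrMr; last exact: lt_le_trans h.
    rewrite mulrC ler_pdivlMr; last by rewrite mulr_gt0// divr_gt0// ltr0n.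
    have u1 : `|1 - q ^+ k| <= k%:R * (1 - q).
      rewrite ger0_norm ?subr_ge0 ?exprn_ile1 ?(ltW q0) ?(ltW q1)//.
      have := @bernoulli_sub (1 - q) k; rewrite opprB addrC subrK => /(_ _).
      by move=> /(_ ltac:(apply/andP; split; lra)); lra.
    apply: le_trans h; apply: le_trans (ler_wpM2r _ u1) _.
      by rewrite mulr_ge0// ?divr_ge0// ltW.
    by rewrite le_eqVlt; apply/orP; left; apply/eqP; field;
      rewrite pnatr_eq0 -lt0n.
  rewrite big_split /= [X in _ * X]prodfV -/(node_gap t x); apply: ler_wpM2r.
    by rewrite invr_ge0 /node_gap prodr_ge0// => k _; rewrite divr_ge0.
  apply: le_trans (prod_const_le _ _ _) _.
    by rewrite invf_ge1// exprn_ile1// ?(ltW q0)// ltW.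
  rewrite exprVn -exprM invf_ple ?posrE ?exprn_gt0//.
  apply: le_trans qDN _; apply: ler_wiXn2l; rewrite ?(ltW q0) ?(ltW q1)//.
  by rewrite leq_mul2l leqnSn orbT.
- by rewrite size_map size_iota map_inj_uniq ?iota_uniq.
- move=> y yr; have [i + ->] := elimT (mapP) yr.
  rewrite mem_iota add0n => /andP[_ iN].
  rewrite exprn_ge0 ?exprn_ile1 ?(ltW q0) ?(ltW q1)//; split=> //.
  rewrite /root /p horner_sum.
  (* The value of [p] at q^i is [W 0] times the divided difference of X^i at the points q^j, since
     (q^i)^j = (q^j)^i; [s] has one more element than [t], so i < N suffices. *)
  have := @divided_difference_pow R s (fun j => q ^+ j) i us
    (fun x y _ _ h => qinj x y h) iN.
  rewrite -/(W _) => E.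
  rewrite (eq_bigr (fun j => W 0%N * ((q ^+ j) ^+ i / W j))) -?mulr_sumr ?E
    ?mulr0//.
  by move=> j _; rewrite hornerZ hornerXn /a exprAC; ring.
Qed.
End VanishingPolynomial.

(** * Products over squares *)

Section SquareNodes.
Context {R : realType}.

(** The quotient of the binomials is the product of (K + j - r) / (K - r) over r < i, and each
    factor is at least [rho]. *)
Lemma binD_ge (rho : R) K j i : 1 <= rho -> (rho - 1) * K%:R <= j%:R ->
  (i <= K)%N ->
  rho ^+ i * 'C(K, i)%:R <= 'C(K + j, i)%:R.
Proof.
move=> r1 rK; elim: i => [|i IH iK]; first by rewrite !bin0 expr0 mul1r.
have i1 : 0 < i.+1%:R :> R by rewrite ltr0n.
rewrite -(ler_pM2l i1) -natrM mul_bin_left natrM.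
rewrite (_ : i.+1%:R * _ = rho ^+ i.+1 * (i.+1 * 'C(K, i.+1))%:R);
  last by rewrite natrM; ring.
rewrite mul_bin_left natrM.
have {}IH := IH (ltnW iK).
have iKR : i%:R <= K%:R :> R by rewrite ler_nat ltnW.
rewrite (natrB _ (ltnW iK)) (natrB _ (leq_trans (ltnW iK) (leq_addr j K)))
  natrD.
have h : rho * (K%:R - i%:R) <= K%:R + j%:R - i%:R.
  have : (rho - 1) * i%:R >= 0 by rewrite mulr_ge0 ?subr_ge0.
  by lra.
rewrite (_ : _ * _ = rho * (K%:R - i%:R) * (rho ^+ i * 'C(K, i)%:R));
  last by rewrite exprS; ring.
apply: ler_pM => //; last by rewrite mulr_ge0 ?exprn_ge0//; lra.
by rewrite mulr_ge0 ?subr_ge0//; lra.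
Qed.

Definition sqr_ratio (j k : nat) : R := `|j%:R ^+ 2 - k%:R ^+ 2| / k%:R ^+ 2.

(** Split (j^2 - k^2) / k^2 into (j + k) / k and (j - k) / k; each product is a binomial
    coefficient. *)
Lemma prod_sqr_ratio_lt j K : (K < j)%N ->
  \prod_(1 <= k < K.+1) sqr_ratio j k = 'C(j + K, K)%:R * 'C(j.-1, K)%:R.
Proof.
elim: K => [|K IH] Kj; first by rewrite big_geq// !bin0 mulr1.
rewrite big_nat_recr//= IH ?(ltnW Kj)//.
have K1 : K.+1%:R != 0 :> R by rewrite pnatr_eq0.
apply: (mulfI (mulf_neq0 K1 K1)).
have b1 : K.+1%:R * 'C(j + K.+1, K.+1)%:R =
  (j + K.+1)%:R * 'C(j + K, K)%:R :> R.
  by rewrite -!natrM -mul_bin_diag addnS.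
have b2 : K.+1%:R * 'C(j.-1, K.+1)%:R = (j.-1 - K)%:R * 'C(j.-1, K)%:R :> R.
  by rewrite -!natrM mul_bin_left.
rewrite [RHS]mulrACA b1 b2 /sqr_ratio ger0_norm; last first.
  by rewrite subr_ge0 lerXn2r ?nnegrE// ler_nat ltnW.
have -> : (j.-1 - K)%:R = j%:R - K.+1%:R :> R.
  by rewrite -natrB 1?ltnW//; congr (_%:R); lia.
by rewrite natrD; field.
Qed.

Definition sqr_ratio_off (j k : nat) : R := if k == j then 1 else sqr_ratio j k.

Lemma prod_sqr_ratio_off_lt j K : (K < j)%N ->
  \prod_(1 <= k < K.+1) sqr_ratio_off j k = 'C(j + K, K)%:R * 'C(j.-1, K)%:R.
Proof.
move=> Kj; rewrite -prod_sqr_ratio_lt//; apply: eq_big_nat => k /andP[_ kK].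
by rewrite /sqr_ratio_off ltn_eqF// (leq_ltn_trans _ Kj).
Qed.

(** Induction from K = j, where the product is 'C(2j - 1, j - 1), half of 'C(2j, j); this is the
    origin of the 2. *)
Lemma prod_sqr_ratio_off_ge j K : (0 < j)%N -> (j <= K)%N ->
  \prod_(1 <= k < K.+1) sqr_ratio_off j k = 'C(K + j, j)%:R / 'C(K, j)%:R / 2.
Proof.
move=> j0; elim: K => [|K IH]; first by rewrite leqNgt j0.
rewrite leq_eqVlt => /orP[/eqP jE|]; last first.
  rewrite ltnS => jK; rewrite big_nat_recr//= (IH jK).
  have cK : 'C(K, j)%:R != 0 :> R by rewrite pnatr_eq0 -lt0n bin_gt0.
  have cK1 : 'C(K.+1, j)%:R != 0 :> R by rewrite pnatr_eq0 -lt0n bin_gt0 ltnW.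
  have K1 : K.+1%:R != 0 :> R by rewrite pnatr_eq0.
  have Kj0 : K.+1%:R - j%:R != 0 :> R.
    by rewrite subr_eq0 eqr_nat gtn_eqF.
  have b1 : K.+1%:R * 'C(K.+1 + j, j)%:R = (K.+1 + j)%:R * 'C(K + j, j)%:R :> R.
    rewrite -!natrM; congr (_%:R).
    by have := mul_bin_down (K.+1 + j) j; rewrite addnK addSn /= => ->.
  have b2 : (K.+1%:R - j%:R) * 'C(K.+1, j)%:R = K.+1%:R * 'C(K, j)%:R :> R.
    by rewrite -natrB 1?ltnW// -!natrM; congr (_%:R);
      have := mul_bin_down K.+1 j.
  rewrite /sqr_ratio_off gtn_eqF// /sqr_ratio distrC ger0_norm; last first.
    by rewrite subr_ge0 lerXn2r ?nnegrE// ler_nat ltnW.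
  have -> : 'C(K.+1 + j, j)%:R =
    (K.+1%:R + j%:R) * 'C(K + j, j)%:R / K.+1%:R :> R.
    by rewrite -natrD -b1 mulrC mulKf.
  have -> : 'C(K.+1, j)%:R = K.+1%:R * 'C(K, j)%:R / (K.+1%:R - j%:R) :> R.
    by rewrite -b2 mulrC mulKf.
  move: cK K1 Kj0; move: ('C(K, j)%:R : R) ('C(K + j, j)%:R : R) (K.+1%:R : R)
    (j%:R : R).
  by move=> c d k i c0 k0 ki; field; rewrite c0 k0 ki.
rewrite big_nat_recr//= prod_sqr_ratio_off_lt -?jE// /sqr_ratio_off eqxx mulr1.
rewrite jE /= !binn divr1 mulr1.
have K1 : K.+1%:R != 0 :> R by rewrite pnatr_eq0.
apply: (mulfI K1); rewrite mulrA -!natrM.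
have -> : (K.+1 * 'C(K.+1 + K.+1, K.+1) = K.+1 * 2 * 'C(K.+1 + K, K))%N.
  have := mul_bin_diag (K.+1 + K.+1) K; rewrite addSn /= -addSnnS => <-.
  by congr (_ * _)%N; lia.
by rewrite !natrM; field.
Qed.

Lemma prod_sqr_ratio_off_ge_half (rho : R) j K : (0 < j)%N -> 1 <= rho ->
  ((j <= K)%N -> (rho - 1) * K%:R <= j%:R) -> ((K < j)%N -> rho = 1) ->
  rho ^+ j / 2 <= \prod_(1 <= k < K.+1) sqr_ratio_off j k.
Proof.
move=> j0 r1 rK rK'; have [jK|Kj] := leqP j K.
  rewrite prod_sqr_ratio_off_ge// ler_pM2r ?invr_gt0// ler_pdivlMr ?ltr0n
    ?bin_gt0//.
  exact: binD_ge (rK jK) jK.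
rewrite rK'// expr1n prod_sqr_ratio_off_lt// -natrM.
have : (1 <= 'C(j + K, K) * 'C(j.-1, K))%N.
  by rewrite muln_gt0 !bin_gt0 leq_addl; lia.
rewrite -(ler_nat R); lra.
Qed.

Lemma telescope_succ K : \prod_(1 <= k < K.+1) (k%:R / k.+1%:R) =
  K.+1%:R^-1 :> R.
Proof.
elim: K => [|K IH]; first by rewrite big_geq// invr1.
by rewrite big_nat_recr//= IH mulKf// pnatr_eq0.
Qed.

Definition gap_loss (j k : nat) : R :=
  if k == j then 1 else `|j%:R - k%:R| / (`|j%:R - k%:R| + 1).

(** The product telescopes on either side of [j]: to 1 / j below and 1 / (K - j + 1) above. *)
Lemma prod_gap_loss j K : (0 < j)%N ->
  (j%:R * K.+1%:R)^-1 <= \prod_(1 <= k < K.+1) gap_loss j k :> R.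
Proof.
move=> j0; have jR : 0 < j%:R :> R by rewrite ltr0n.
have lo k : (k < j)%N -> \prod_(1 <= i < k.+1) gap_loss j i =
  (j%:R - k%:R) / j%:R.
  elim: k => [|k IH] kj; first by rewrite big_geq// subr0 divff// gt_eqF.
  rewrite big_nat_recr//= IH ?(ltnW kj)// /gap_loss ltn_eqF//.
  have kjR : k.+1%:R < j%:R :> R by rewrite ltr_nat.
  rewrite ger0_norm ?subr_ge0 1?ltW//; move: kjR jR; rewrite -natr1.
  move: (j%:R : R) (k%:R : R) => u v uv u0.
  by field; rewrite !gt_eqF//; lra.
have [jK|Kj] := leqP j K; last first.
  rewrite lo// invfM mulrC; apply: ler_wpM2r; first by rewrite invr_ge0.
  have h : K.+1%:R <= j%:R :> R by rewrite ler_nat.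
  have : K.+1%:R^-1 <= 1 :> R by rewrite invf_le1 ?ler1n.
  by move: h; rewrite -natr1; lra.
suff -> : \prod_(1 <= k < K.+1) gap_loss j k = (j%:R * (K%:R - j%:R + 1))^-1.
  have h : j%:R <= K%:R :> R by rewrite ler_nat.
  have p1 : 0 < K%:R - j%:R + 1 :> R by lra.
  by rewrite lef_pV2 ?posrE ?mulr_gt0// ler_pM2l// -natr1 lerD2r gerBl.
elim: K jK => [|K IH]; first by rewrite leqNgt j0.
rewrite leq_eqVlt => /orP[/eqP jE|]; last first.
  rewrite ltnS => jK; rewrite big_nat_recr//= IH// /gap_loss gtn_eqF//.
  have h : j%:R <= K%:R :> R by rewrite ler_nat.
  rewrite distrC -natr1 ger0_norm; last by lra.
  by field; rewrite !gt_eqF//; lra.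
rewrite big_nat_recr//= lo -?jE// /gap_loss eqxx mulr1 jE subrr add0r mulr1
  -natr1.
have K0 : 0 <= K%:R :> R by [].
by field; rewrite gt_eqF//; lra.
Qed.
End SquareNodes.

(** * Shifted families of squares *)

(* Family [l] stops at [4 ^ l], so that the number of nodes up to [x] is of order
   [sqrt x] times a factor decreasing linearly in [ln x]. The shifts keep the
   families disjoint: consecutive squares from [4 L^2] on are more than [L]
   apart. *)
Definition square_nodes (L : nat) : seq nat :=
  [seq (k ^ 2 + l)%N | l <- iota 0 L, k <- index_iota L.*2 (2 ^ l).+1].

Lemma square_nodesP L x : reflect
  (exists l k, [/\ (l < L)%N, (L.*2 <= k <= 2 ^ l)%N & x = (k ^ 2 + l)%N])
  (x \in square_nodes L).
Proof.
apply: (iffP allpairsPdep) => -[l [k]].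
  by rewrite mem_index_iota mem_iota add0n => -[? ? ->]; exists l, k.
by move=> [? ? ->]; exists l, k; rewrite mem_index_iota mem_iota add0n.
Qed.

Lemma square_nodes_inj L l k l' k' : (l < L)%N -> (l' < L)%N ->
  (L.*2 <= k)%N -> (L.*2 <= k')%N -> (k ^ 2 + l = k' ^ 2 + l')%N ->
  l = l' /\ k = k'.
Proof.
move=> lL l'L Lk Lk' E; suff kk : k = k' by move: E; rewrite kk => /addnI.
by move: E; rewrite !expnS !expn0 !muln1; case: (ltngtP k k') => // h; nia.
Qed.

Lemma square_nodes_uniq L : uniq (square_nodes L).
Proof.
apply: allpairs_uniq_dep; [exact: iota_uniq|by move=> l _; exact: iota_uniq|].
move=> _ _ /allpairsPdep[l [k [lL kL ->]]] /allpairsPdep[l' [k' [lL' kL' ->]]]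
  /= E.
move: lL kL lL' kL'; rewrite !mem_index_iota !mem_iota !add0n /=.
move=> lL /andP[kL _] lL' /andP[kL' _].
by have [-> ->] := square_nodes_inj lL lL' kL kL' E.
Qed.

Lemma square_nodes_gt0 L : 0%N \notin square_nodes L.
Proof.
apply/negP => /square_nodesP[l [k [lL /andP[Lk _]]]].
by rewrite !expnS expn0 muln1; nia.
Qed.

(** The last family, l = L, already has this many nodes. *)
Lemma size_square_nodes L : (2 ^ L < size (square_nodes L.+1) + L.+1.*2)%N.
Proof.
rewrite /square_nodes size_allpairs_dep.
have -> : iota 0 L.+1 = iota 0 L ++ [:: L] by rewrite -[L.+1]addn1 iotaD.
by rewrite map_cat sumn_cat /= size_iota; lia.
Qed.

(** * Lower bounds for the products over the nodes *)

Section NodeGap.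
Context {R : realType}.

(* A lower bound for [|x - y| / y], where [x = j ^ 2 + m] and [y = k ^ 2 + l], that
   does not depend on the shifts [m] and [l]. *)
Definition node_loss (j k : nat) : R :=
  gap_loss j k * (k%:R / k.+1%:R) * sqr_ratio_off j k *
  (if k == j then (2 * j%:R ^+ 2)^-1 else 1).

Lemma gap_loss_ge0 j k : 0 <= gap_loss j k :> R.
Proof. by rewrite /gap_loss; case: ifP => // _; rewrite divr_ge0 ?addr_ge0. Qed.

Lemma gap_loss_le1 j k : gap_loss j k <= 1 :> R.
Proof.
rewrite /gap_loss; case: ifP => // _.
have h := normr_ge0 (j%:R - k%:R : R).
by rewrite ler_pdivrMr; lra.
Qed.

Lemma succ_ratio_bounds k : 0 <= (k%:R / k.+1%:R : R) <= 1.
Proof. by rewrite divr_ge0//= ler_pdivrMr ?ltr0n// mul1r ler_nat. Qed.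

Lemma node_loss_gt0 j k : (0 < j)%N -> (0 < k)%N -> 0 < node_loss j k.
Proof.
move=> j0 k0; have kR : 0 < k%:R :> R by rewrite ltr0n.
have jR : 0 < j%:R :> R by rewrite ltr0n.
rewrite /node_loss /gap_loss /sqr_ratio_off /sqr_ratio; case: ifPn => [_|kj].
  by rewrite mul1r mulr1 mulr_gt0 ?divr_gt0 ?invr_gt0 ?mulr_gt0 ?exprn_gt0
    ?ltr0n.
have n0 : 0 < `|j%:R - k%:R| :> R by rewrite normr_gt0 subr_eq0 eqr_nat eq_sym.
rewrite mulr1; apply: mulr_gt0.
  by apply: mulr_gt0; rewrite divr_gt0 ?addr_gt0 ?ltr0n.
rewrite divr_gt0 ?exprn_gt0// normr_gt0 subr_sqr mulf_neq0 -?normr_gt0//.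
by rewrite normr_gt0 gt_eqF// addr_gt0.
Qed.

(** Exact formulas exist for products starting at k = 1; this controls the division by the factors
    with k < 2L. *)
Lemma node_loss_le_sqr j k : (0 < k)%N -> (k < j)%N -> node_loss j k <=
  j%:R ^+ 2.
Proof.
move=> k0 kj; rewrite /node_loss /sqr_ratio_off ltn_eqF// mulr1.
have kR : 1 <= k%:R :> R by rewrite ler1n.
have kjR : k%:R <= j%:R :> R by rewrite ler_nat ltnW.
have /andP[s0 s1] := succ_ratio_bounds k.
have r0 : 0 <= sqr_ratio j k :> R by rewrite divr_ge0 ?sqr_ge0.
rewrite -[leRHS]mul1r; apply: ler_pM => //.
- by rewrite mulr_ge0 ?gap_loss_ge0.
- by rewrite mulr_ile1 ?gap_loss_ge0 ?gap_loss_le1.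
have k2 : 1 <= k%:R ^+ 2 :> R by rewrite exprn_ege1.
rewrite /sqr_ratio ler_pdivrMr ?exprn_gt0 ?ltr0n// ger0_norm; last first.
  by rewrite subr_ge0 lerXn2r ?nnegrE.
have : 0 <= j%:R ^+ 2 * (k%:R ^+ 2 - 1) :> R by rewrite mulr_ge0 ?sqr_ge0
  ?subr_ge0.
lra.
Qed.

(** For k <> j put s = |j - k|. The shifts differ by at most (j + k) / 4, so |x - y| >= (s - 1/4)(j
    + k), and s / (s + 1) pays for the 1/4 because s >= 1. The factor k / (k + 1) pays for y <= k^2
    + k. *)
Lemma node_loss_le_gap L j m k l : (m < L)%N -> (l < L)%N ->
    (L.*2 <= j)%N -> (L.*2 <= k)%N ->
  node_loss j k <= if (k ^ 2 + l != j ^ 2 + m)%N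
    then `|(j ^ 2 + m)%:R - (k ^ 2 + l)%:R| / (k ^ 2 + l)%:R else 1.
Proof.
move=> mL lL Lj Lk; set x := (j ^ 2 + m)%N; set y := (k ^ 2 + l)%N.
have L2 : (2 <= L.*2)%N by case: (L) mL.
have jR : 1 <= j%:R :> R by rewrite ler1n; lia.
have kR : 1 <= k%:R :> R by rewrite ler1n; lia.
have yR : y%:R = k%:R ^+ 2 + l%:R :> R by rewrite natrD natrX.
have xR : x%:R = j%:R ^+ 2 + m%:R :> R by rewrite natrD natrX.
(* Equal squares with different shifts: the nodes are at least 1 apart and y <= 2 j^2. *)
have [kj|kj] := eqVneq k j.
  have small : node_loss j k <= (2 * j%:R ^+ 2)^-1.
    rewrite /node_loss /gap_loss /sqr_ratio_off kj eqxx mul1r mulr1.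
    have /andP[s0 s1] := succ_ratio_bounds j.
    by rewrite ler_piMl// invr_ge0 mulr_ge0 ?sqr_ge0.
  have j2 : 1 <= j%:R ^+ 2 :> R by rewrite exprn_ege1.
  apply: (le_trans small); case: ifPn => yx; last by rewrite invf_le1; lra.
  have y0 : 0 < y%:R :> R by rewrite yR kj; have : 0 <= l%:R :> R by []; lra.
  rewrite ler_pdivlMr// mulrC ler_pdivrMr; last by lra.
  have n1 : 1 <= `|x%:R - y%:R| :> R.
    case: (ltngtP x y) yx => // h _.
      by rewrite distrC -natrB ?(ltnW h)// normr_nat ler1n subn_gt0.
    by rewrite -natrB ?(ltnW h)// normr_nat ler1n subn_gt0.
  have lj : l%:R <= j%:R :> R by rewrite ler_nat; lia.
  have jj : j%:R <= j%:R ^+ 2 :> R by rewrite expr2 ler_peMl//; lra.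
  have yb : y%:R <= 2 * j%:R ^+ 2 :> R by rewrite yR kj; lra.
  by apply: le_trans yb _; rewrite -[leLHS]mul1r; apply: ler_wpM2r => //; lra.
have -> : y != x.
  by apply: contra kj => /eqP /(square_nodes_inj lL mL Lk Lj)[_ ->].
rewrite /node_loss /gap_loss /sqr_ratio_off (negPf kj) mulr1 /sqr_ratio.
pose s : R := `|j%:R - k%:R|.
have s1 : 1 <= s.
  rewrite /s; case: (ltngtP k j) kj => // h _.
    by rewrite -natrB ?(ltnW h)// normr_nat ler1n subn_gt0.
  by rewrite distrC -natrB ?(ltnW h)// normr_nat ler1n subn_gt0.
have d2 : `|j%:R ^+ 2 - k%:R ^+ 2| = s * (j%:R + k%:R) :> R.
  by rewrite subr_sqr normrM [X in _ * X]ger0_norm// addr_ge0.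
have ml : `|m%:R - l%:R| <= (j%:R + k%:R) / 4 :> R.
  have m0 : 0 <= m%:R :> R by [].
  have l0 : 0 <= l%:R :> R by [].
  have mj : 2 * m%:R <= j%:R :> R by rewrite -natrM ler_nat; lia.
  have lk : 2 * l%:R <= k%:R :> R by rewrite -natrM ler_nat; lia.
  have mk : 2 * m%:R <= k%:R :> R by rewrite -natrM ler_nat; lia.
  have lj : 2 * l%:R <= j%:R :> R by rewrite -natrM ler_nat; lia.
  by rewrite ler_norml; apply/andP; split; lra.
have xy : s * (j%:R + k%:R) - (j%:R + k%:R) / 4 <= `|x%:R - y%:R|.
  rewrite -d2 xR yR (_ : j%:R ^+ 2 + m%:R - (k%:R ^+ 2 + l%:R) =
    (j%:R ^+ 2 - k%:R ^+ 2) - (l%:R - m%:R)); last by ring.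
  by apply: le_trans (lerB_dist _ _); rewrite lerD2l lerN2 distrC.
have lk : l%:R <= k%:R :> R by rewrite ler_nat; lia.
have yk : 0 < (y%:R : R) <= k%:R ^+ 2 + k%:R.
  by rewrite yR lerD2l lk andbT; apply: ltr_pwDl => //; rewrite exprn_gt0//;
    lra.
have /andP[y0 yk'] := yk.
rewrite -/s d2 ler_pdivlMr// -natr1.
apply: (le_trans _ xy).
have k0 : 0 < k%:R :> R by lra.
apply: (@le_trans _ _ (s / (s + 1) * (k%:R / (k%:R + 1))
  * (s * (j%:R + k%:R) / k%:R ^+ 2) * (k%:R ^+ 2 + k%:R))).
  apply: ler_wpM2l => //.
  by rewrite !mulr_ge0 ?invr_ge0 ?exprn_ge0//; lra.
rewrite (_ : _ * _ = s * s * (j%:R + k%:R) / (s + 1)); last first.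
  by field; rewrite !gt_eqF//; lra.
rewrite ler_pdivrMr; last by lra.
rewrite (_ : (s * _ - _) * _ = ((s - 4^-1) * (s + 1)) * (j%:R + k%:R));
  last by field.
apply: ler_wpM2r; first by lra.
nra.
Qed.

Lemma prod_if_eq_ge (c : R) j K : 0 <= c <= 1 ->
  c <= \prod_(1 <= k < K.+1) (if k == j then c else 1).
Proof.
move=> /andP[c0 c1].
suff -> : \prod_(1 <= k < K.+1) (if k == j then c else 1) =
  if (0 < j <= K)%N then c else 1.
  by case: ifP.
elim: K => [|K IH]; first by rewrite big_geq//; case: j.
rewrite big_nat_recr//= IH.
case: (boolP (0 < j <= K)%N) => h1; case: (boolP (0 < j <= K.+1)%N) => h2;
  case: (eqVneq K.+1 j) => h3; rewrite ?mulr1 ?mul1r//; exfalso; lia.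
Qed.

(** The product from k = 1 is bounded factor by factor. Dividing out k < 2L costs at most j^(4L),
    and the remaining losses, polynomial in [j] and [K], are at most 2^(7L) because j and K + 1 do
    not exceed 2^L. *)
Lemma prod_node_loss_ge (rho : R) L j K : (1 < L)%N -> (L.*2 <= j)%N ->
    (j <= 2 ^ L)%N -> (K < 2 ^ L)%N -> 1 <= rho ->
    ((j <= K)%N -> (rho - 1) * K%:R <= j%:R) -> ((K < j)%N -> rho = 1) ->
  rho ^+ j / (2 ^+ (7 * L) * j%:R ^+ (4 * L)) <=
    \prod_(L.*2 <= k < K.+1) node_loss j k.
Proof.
move=> L1 Lj jL KL r1 rK rK'.
have j0 : (0 < j)%N by lia.
have jR : 1 <= j%:R :> R by rewrite ler1n.
have j4 : 1 <= j%:R ^+ (4 * L) :> R by rewrite exprn_ege1.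
have p7 : 1 <= 2 ^+ (7 * L) :> R by rewrite exprn_ege1// ler1n.
have [KL2|LK] := ltnP K.+1 L.*2.
  rewrite rK' ?expr1n; last by lia.
  rewrite big_geq ?(ltnW KL2)// ler_pdivrMr ?mul1r; last by rewrite mulr_gt0;
    lra.
  by rewrite -[leLHS]mulr1; apply: ler_pM.
have split : \prod_(1 <= k < K.+1) node_loss j k =
   \prod_(1 <= k < L.*2) node_loss j k * \prod_(L.*2 <= k < K.+1) node_loss j
     k :> R.
  by rewrite (@big_cat_nat _ _ _ L.*2)//=; lia.
have small : \prod_(1 <= k < L.*2) node_loss j k <= j%:R ^+ (4 * L) :> R.
  apply: (@le_trans _ _ (\prod_(1 <= k < L.*2) j%:R ^+ 2)).
    rewrite big_seq [leRHS]big_seq; apply: ler_prod => k;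
      rewrite mem_index_iota => /andP[k1 k2].
    by rewrite ltW ?node_loss_gt0// node_loss_le_sqr// (leq_trans k2).
  rewrite prodr_const_nat -exprM; apply: ler_weXn2l => //; lia.
have pos : 0 < \prod_(1 <= k < L.*2) node_loss j k :> R.
  by rewrite big_seq; apply: prodr_gt0 => k;
    rewrite mem_index_iota => /andP[k1 _]; exact: node_loss_gt0.
have full : (j%:R * K.+1%:R)^-1 * K.+1%:R^-1 * (rho ^+ j / 2)
  * (2 * j%:R ^+ 2)^-1 <=
    \prod_(1 <= k < K.+1) node_loss j k :> R.
  rewrite /node_loss 3!big_split /=.
  have K0 : 0 <= K.+1%:R^-1 :> R by rewrite invr_ge0.
  have jK0 : 0 <= (j%:R * K.+1%:R)^-1 :> R by rewrite invr_ge0 mulr_ge0.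
  have rh : 0 <= rho ^+ j / 2 by rewrite divr_ge0 ?exprn_ge0//; lra.
  have jj : 1 <= j%:R ^+ 2 :> R by rewrite exprn_ege1.
  have j2 : 0 <= ((2 * j%:R ^+ 2)^-1 : R) <= 1.
    by rewrite invr_ge0 invf_le1; [apply/andP; split; lra|lra].
  have /andP[j20 _] := j2.
  apply: ler_pM;
    [exact: mulr_ge0 (mulr_ge0 jK0 K0) rh|by []| |exact: prod_if_eq_ge].
  apply: ler_pM; [exact: mulr_ge0|by []| |exact: prod_sqr_ratio_off_ge_half].
  apply: ler_pM; [by []|by []|exact: prod_gap_loss|by rewrite telescope_succ].
have bound : 4 * j%:R ^+ 3 * K.+1%:R ^+ 2 <= 2 ^+ (7 * L) :> R.
  have T4 : 4 <= 2 ^+ L :> R by rewrite (_ : 4 = 2 ^+ 2) ?ler_weXn2l ?ler1n//;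
    ring.
  have jT : j%:R <= 2 ^+ L :> R by rewrite -natrX ler_nat.
  have KT : K.+1%:R <= 2 ^+ L :> R by rewrite -natrX ler_nat.
  rewrite mulnC exprM; move: (2 ^+ L : R) T4 jT KT => T T4 jT KT.
  have j3 : j%:R ^+ 3 <= T ^+ 3 by rewrite lerXn2r ?nnegrE//; lra.
  have K2 : K.+1%:R ^+ 2 <= T ^+ 2 by rewrite lerXn2r ?nnegrE//; lra.
  have T2 : 4 <= T ^+ 2 by rewrite expr2; nra.
  rewrite (_ : T ^+ 7 = T ^+ 2 * T ^+ 3 * T ^+ 2); last by ring.
  by apply: ler_pM => //; apply: ler_pM.
have K0 : 0 < K.+1%:R :> R by rewrite ltr0n.
have rj : 0 < rho ^+ j by rewrite exprn_gt0//; lra.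
rewrite -(ler_pM2l pos) -split; apply: le_trans full.
apply: (@le_trans _ _ (j%:R ^+ (4 * L)
  * (rho ^+ j / (2 ^+ (7 * L) * j%:R ^+ (4 * L))))).
  by apply: ler_wpM2r => //; rewrite divr_ge0 ?mulr_ge0 ?exprn_ge0//; lra.
rewrite (_ : j%:R ^+ (4 * L) * _ = rho ^+ j / 2 ^+ (7 * L)); last first.
  by field; rewrite !gt_eqF//; lra.
rewrite (_ : _ * (2 * j%:R ^+ 2)^-1 =
  rho ^+ j / (4 * j%:R ^+ 3 * K.+1%:R ^+ 2)); last first.
  by move: (K.+1%:R) K0 => k k0; field; rewrite !gt_eqF//; lra.
have q1 : 0 < 4 * j%:R ^+ 3 * K.+1%:R ^+ 2 :> R.
  by rewrite mulr_gt0 ?mulr_gt0 ?exprn_gt0//; lra.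
have q2 : 0 < 2 ^+ (7 * L) :> R by lra.
by rewrite ler_pM2l// lef_pV2 ?posrE.
Qed.

(** With x = j^2 + m, the exponential gain comes from a single family, the first one reaching [j];
    each of the [L] families may lose the factor in the denominator. *)
Lemma node_gap_square_nodes L x : (1 < L)%N -> x \in square_nodes L ->
  exists j, [/\ (0 < j)%N, (x <= (2 * j) ^ 2)%N &
    (3 / 2) ^+ j / (2 ^+ (7 * L) * j%:R ^+ (4 * L)) ^+ L <=
      node_gap (square_nodes L) x :> R].
Proof.
move=> L1 /square_nodesP[m [j [mL /andP[Lj jm] ->]]].
have j2 : (1 < j)%N by lia.
have mjj : (2 ^ m <= 2 ^ L)%N by rewrite leq_exp2l// ltnW.
exists j; split; [lia| |].
  by rewrite !expnS !expn0 !muln1; nia.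
(* From j <= 2^l0 <= 2j the value rho = 3/2 is admissible for this family, and l0 <= m < L shows
   that it occurs. *)
pose l0 := up_log 2 j.
have /andP[l0j jl0] := up_log_bounds (ltnSn 1) j2.
have l0L : (l0 < L)%N by apply: leq_ltn_trans mL; exact: up_log_min.
have l01 : (0 < l0)%N by rewrite up_log_gt0.
have l0jj : (2 ^ l0 <= 2 * j)%N.
  by rewrite -(prednK l01) expnS leq_mul2l; exact: ltnW.
rewrite /node_gap big_mkcond big_allpairs_dep /=.
pose c : R := (2 ^+ (7 * L) * j%:R ^+ (4 * L))^-1.
pose rho l : R := if l == l0 then 3 / 2 else 1.
have rho1 l : 1 <= rho l by rewrite /rho; case: ifP => _; lra.
apply: (@le_trans _ _ (\prod_(l <- iota 0 L) (rho l ^+ j * c))).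
  rewrite big_split /= [X in _ <= _ * X]big_const_seq count_predT size_iota
    iter_mulr_1 exprVn.
  rewrite (bigD1_seq l0) ?iota_uniq ?mem_iota//= /rho eqxx big1 ?mulr1// =>
    l /negPf ->.
  by rewrite expr1n.
rewrite big_seq [leRHS]big_seq; apply: ler_prod => l;
  rewrite mem_iota add0n => /andP[_ lL].
rewrite mulr_ge0 ?exprn_ge0 ?invr_ge0 ?mulr_ge0 ?exprn_ge0
  ?(le_trans _ (rho1 l))//=.
have l2L : (2 ^ l < 2 ^ L)%N by rewrite ltn_exp2l.
apply: le_trans (prod_node_loss_ge L1 Lj _ l2L (rho1 l) _ _) _.
- exact: leq_trans mjj.
- move=> jl; rewrite /rho; case: eqP => [->|_]; last by rewrite subrr mul0r.
  have : (2 ^ l0)%:R <= (2 * j)%:R :> R by rewrite ler_nat.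
  by rewrite natrM; lra.
- by move=> lj; rewrite /rho; case: eqP => // ll0; move: lj;
  rewrite ll0 ltnNge jl0.
rewrite big_seq [leRHS]big_seq; apply: ler_prod => k;
  rewrite mem_index_iota => /andP[Lk _].
rewrite ltW/= ?node_loss_gt0//; [|lia|lia].
exact: (node_loss_le_gap mL lL Lj Lk).
Qed.
End NodeGap.

(** * The choice of parameters *)

Lemma half_pow_le_size_square_nodes M : (5 < M)%N ->
  (2 ^ M.-1 <= size (square_nodes M.+1))%N.
Proof.
move=> M5; have := size_square_nodes M.
have : (M.+1.*2 <= 2 ^ M.-1)%N.
  case: M M5 => //= m; elim: m => // m IH.
  rewrite ltnS leq_eqVlt => /orP[/eqP <- //|/IH]; rewrite expnS; lia.
have : (2 ^ M = 2 * 2 ^ M.-1)%N by rewrite -expnS prednK//; lia.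
lia.
Qed.

Section NodeNumber.
Context {R : realType}.

Lemma expR_third_le : expR (3^-1) <= 3 / 2 :> R.
Proof.
have := expR_ge1Dx (- 3^-1 : R); rewrite expRN => h.
have e0 := expR_gt0 (3^-1 : R).
have : (1 + - 3^-1) * expR 3^-1 <= 1 :> R.
  by rewrite -[leRHS](mulVf (lt0r_neq0 e0)) ler_wpM2r// ltW.
lra.
Qed.

(** With W = 40 L^2, the inequality ln j <= ln W + j / W bounds j^(4 L^2) by exp (4 L^2 ln W + j /
    10). The terms free of [j] are absorbed by [A], and j / 10 - j / 3 <= - j / 5. *)
Lemma node_weight_bound (A : R) L j : (0 < L)%N -> (0 < j)%N ->
  1 + 7 * L%:R ^+ 2 + 4 * L%:R ^+ 2 * ln (40 * L%:R ^+ 2) <= A ->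
  expR (- A) * (2 / ((3 / 2) ^+ j / (2 ^+ (7 * L) * j%:R ^+ (4 * L)) ^+ L)) <=
    expR (- (10^-1 * (2 * j%:R))).
Proof.
move=> L0 j0 hA; have L1 : 1 <= L%:R :> R by rewrite ler1n.
have L2 : 1 <= L%:R ^+ 2 :> R by rewrite exprn_ege1.
have jR : 0 < j%:R :> R by rewrite ltr0n.
pose W : R := 40 * L%:R ^+ 2; have W0 : 0 < W by rewrite /W; lra.
have b1 : 2 <= expR 1 :> R by have := expR_ge1Dx (1 : R); lra.
have b2 : (2 ^+ (7 * L)) ^+ L <= expR (7 * L%:R ^+ 2) :> R.
  rewrite -exprM (_ : 7 * L%:R ^+ 2 = (7 * L * L)%:R * 1);
    last by rewrite !natrM; ring.
  by rewrite expRM_natl lerXn2r ?nnegrE ?expR_ge0.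
have b3 : (j%:R ^+ (4 * L)) ^+ L <=
  expR (4 * L%:R ^+ 2 * ln W) * expR (j%:R / 10).
  have jW : j%:R <= W * expR (j%:R / W).
    have h := expR_ge1Dx (j%:R / W); rewrite mulrC -ler_pdivrMr//; lra.
  have nE : (4 * L * L)%:R = 4 * L%:R ^+ 2 :> R by rewrite !natrM; ring.
  apply: (@le_trans _ _ ((W * expR (j%:R / W)) ^+ (4 * L * L))).
    by rewrite -exprM lerXn2r ?nnegrE ?mulr_ge0 ?expR_ge0// ltW.
  rewrite exprMn -{1}(lnK W0) -!expRM_natl nE le_eqVlt; apply/orP; left;
    apply/eqP.
  by congr (_ * expR _); rewrite /W; field; rewrite gt_eqF//; lra.
have b4 : expR (j%:R / 3) <= (3 / 2) ^+ j :> R.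
  rewrite expRM_natl lerXn2r ?nnegrE ?expR_ge0 ?expR_third_le//; lra.
have q0 : 0 < (3 / 2) ^+ j :> R by rewrite exprn_gt0//; lra.
rewrite [leLHS](_ : _ = expR (- A) * (2 * (2 ^+ (7 * L) * j%:R ^+ (4 * L)) ^+ L)
  / (3 / 2) ^+ j); last first.
  by rewrite invf_div !mulrA.
rewrite ler_pdivrMr//.
apply: (@le_trans _ _ (expR (- (10^-1 * (2 * j%:R))) * expR (j%:R / 3)));
  last first.
  by apply: ler_wpM2l => //; exact: expR_ge0.
rewrite exprMn.
apply: (@le_trans _ _
  (expR (- A)
  * (expR 1 * (expR (7 * L%:R ^+ 2)
  * (expR (4 * L%:R ^+ 2 * ln W) * expR (j%:R / 10)))))).
  apply: ler_wpM2l; first exact: expR_ge0.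
  have p0 : 0 <= (2 ^+ (7 * L)) ^+ L :> R by rewrite !exprn_ge0.
  have p1 : 0 <= (j%:R ^+ (4 * L)) ^+ L :> R by rewrite !exprn_ge0.
  by apply: ler_pM; [by []|exact: mulr_ge0|exact: b1|exact: ler_pM].
rewrite -!expRD ler_expR; move: hA; rewrite -/W; lra.
Qed.

(** [vanishing_poly] scaled by [expR (- A)]. The rate 1/10 depends on neither [A] nor [L], and sqrt
    n <= 2j turns decay in [j] into decay in sqrt n. *)
Lemma gevrey_poly_with_roots (A : R) L : (1 < L)%N ->
  1 + 7 * L%:R ^+ 2 + 4 * L%:R ^+ 2 * ln (40 * L%:R ^+ 2) <= A -> 0 <= A ->
  exists (p : {poly R}) (r : seq R),
    [/\ p`_0 = expR (- A), forall n, `|p`_n| <=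
      expR (- (10^-1 * Num.sqrt n%:R)),
      uniq r, size r = size (square_nodes L) & forall y, y \in r -> 0 <= y <=
        1 /\ root p y].
Proof.
move=> L1 hA A0.
have [p [r [p0 pn px [ur sr] rr]]] :=
  @vanishing_poly R _ (square_nodes_uniq L) (square_nodes_gt0 L).
exists (expR (- A) *: p), r; split=> //; last first.
- by move=> y /rr[y01 py]; split=> //; rewrite rootZ// expR_eq0.
- move=> n; rewrite coefZ normrM ger0_norm ?expR_ge0//.
  have [n0|nN] := eqVneq n 0%N.
    by rewrite n0 p0 normr1 mulr1 sqrtr0 mulr0 oppr0 expR0 -expR0 ler_expR
      oppr_le0.
  have [nt|nt] := boolP (n \in square_nodes L); last first.
    by rewrite pn ?normr0 ?mulr0 ?expR_ge0// inE (negPf nN).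
  have [j [j0 nj gap]] := @node_gap_square_nodes R _ _ L1 nt.
  have jR : 0 < j%:R :> R by rewrite ltr0n.
  apply: (@le_trans _ _ (expR (- (10^-1 * (2 * j%:R))))); last first.
    rewrite ler_expR lerN2 ler_pM2l ?invr_gt0//.
    rewrite -[leRHS]ger0_norm ?mulr_ge0// -sqrtr_sqr ler_wsqrtr//.
    by rewrite -natrM -natrX ler_nat.
  apply: le_trans (node_weight_bound (ltnW L1) j0 hA).
  apply: ler_wpM2l; first exact: expR_ge0.
  apply: le_trans (px n nt) _; apply: ler_wpM2l => //.
  have d0 : 0 < (3 / 2) ^+ j / (2 ^+ (7 * L) * j%:R ^+ (4 * L)) ^+ L :> R.
    by rewrite divr_gt0 ?exprn_gt0 ?mulr_gt0 ?exprn_gt0//; lra.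
  by rewrite lef_pV2 ?posrE//; apply: lt_le_trans gap.
- by rewrite coefZ p0 mulr1.
Qed.

(** Write A = Z^2 Y^4 with Z = A^(1/2 - eta), Y = A^(eta / 2), and take [L] about Z Y. The logarithm
    costs a multiple of Y, so L^2 ln L is of order Z^2 Y^3, below A; the number of nodes, at least
    2^(L - 2), exceeds exp Z. *)
Lemma exists_node_number (delta : R) : 0 < delta -> exists A0 :
  R, forall A, A0 <= A ->
  exists L, [/\ (1 < L)%N, 0 <= A,
    1 + 7 * L%:R ^+ 2 + 4 * L%:R ^+ 2 * ln (40 * L%:R ^+ 2) <= A &
    expR (A `^ (1 / 2 - delta)) <= (size (square_nodes L))%:R].
Proof.
move=> d0; pose eta := Num.min delta 4^-1.
have e0 : 0 < eta by rewrite lt_min d0 invr_gt0 ltr0n.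
have ed : eta <= delta by rewrite ge_min lexx.
have e4 : eta <= 4^-1 by rewrite ge_min lexx orbT.
(* This is 29 + 16 (159 + 2 / eta): 29 covers 1 + 7 L^2, and 16 is the 4 of the logarithmic term
   times the 4 in L^2 <= 4 Z^2 Y^2. The threshold for [A] below means Y >= K. *)
pose K := 2573 + 32 / eta.
have ie : 0 < eta^-1 by rewrite invr_gt0.
have K1 : 2573 <= K by rewrite /K; lra.
exists (K `^ (2 / eta)) => A hA.
have A1 : 1 <= A.
  apply: le_trans hA; rewrite -[leLHS](powRr0 K); apply: ler_powR; lra.
have A0 : 0 < A by lra.
pose Y := A `^ (eta / 2); pose Z := A `^ (1 / 2 - eta).
have YK : K <= Y.
  have -> : K = (K `^ (2 / eta)) `^ (eta / 2).
    rewrite -powRrM (_ : 2 / eta * (eta / 2) = 1) ?powRr1//; first by lra.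
    by field; rewrite gt_eqF.
  by apply: ge0_ler_powR => //;
    rewrite ?nnegrE ?powR_ge0 ?(ltW A0)// divr_ge0// ltW.
have Z1 : 1 <= Z by rewrite -[leLHS](powRr0 A); apply: ler_powR => //; lra.
have AE : A = Z ^+ 2 * Y ^+ 4.
  rewrite /Z /Y -!powR_mulrn ?powR_ge0// -!powRrM -powRD;
    last by apply/implyP => _; rewrite gt_eqF.
  by rewrite [X in _ `^ X](_ : _ = 1) ?powRr1 ?(ltW A0)//; field.
have lnA : ln A <= 2 / eta * Y.
  have Y0 : 0 < Y by lra.
  have := ln_sublinear Y0; rewrite /Y ln_powR -/Y => h.
  have : 2 / eta * (eta / 2 * ln A) <= 2 / eta * Y.
    by rewrite ler_pM2l ?divr_gt0// ltW.
  by rewrite mulrA (_ : 2 / eta * (eta / 2) = 1) ?mul1r//; field;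
    rewrite gt_eqF.
pose X := Z * Y.
have X6 : 6 <= X by rewrite /X; nra.
pose M := Num.truncn X.
have X0 : 0 <= X by lra.
have /andP[MX _] := truncn_itv X0.
have XM : X < M%:R + 1 by rewrite natr1; exact: truncnS_gt.
exists M.+1.
have M5 : (5 < M)%N by rewrite -(ltr_nat R); lra.
split; [by rewrite ltnS (leq_trans _ M5)|by lra| |].
  have L1 : 1 <= M.+1%:R :> R by rewrite ler1n.
  have LX : M.+1%:R <= 2 * X by rewrite -natr1; lra.
  have L2 : M.+1%:R ^+ 2 <= 4 * (Z ^+ 2 * Y ^+ 2).
    rewrite (_ : 4 * _ = (2 * X) ^+ 2); last by rewrite /X; ring.
    by rewrite lerXn2r ?nnegrE//; lra.
  have L21 : 1 <= M.+1%:R ^+ 2 :> R by rewrite exprn_ege1.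
  have Y1 : 1 <= Y by lra.
  have Y2 : 1 <= Y ^+ 2 by rewrite exprn_ege1.
  have Z2 : 1 <= Z ^+ 2 by rewrite exprn_ege1.
  have lnL : ln (40 * M.+1%:R ^+ 2) <= (159 + 2 / eta) * Y.
    apply: (@le_trans _ _ (ln (160 * A))).
      rewrite ler_ln ?posrE; [|lra|lra].
      have : Z ^+ 2 * Y ^+ 2 <= A.
        rewrite AE (_ : Y ^+ 4 = Y ^+ 2 * Y ^+ 2); last by ring.
        by rewrite ler_pM2l ?ler_peMl//; lra.
      lra.
    rewrite lnM ?posrE ?ltr0n//.
    have l160 : ln 160 <= 159 :> R.
      by have := @le_ln1Dx R 159; rewrite (_ : 1 + 159 = 160);
        [apply; lra|ring].
    by rewrite mulrDl; lra.
  have q0 : 0 <= Z ^+ 2 * Y ^+ 2 by rewrite mulr_ge0; lra.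
  have ln0 : 0 <= (159 + 2 / eta) * Y by rewrite mulr_ge0//; lra.
  have m1 : M.+1%:R ^+ 2 * ln (40 * M.+1%:R ^+ 2) <=
    4 * (Z ^+ 2 * Y ^+ 2) * ((159 + 2 / eta) * Y).
    apply: (@le_trans _ _ (M.+1%:R ^+ 2 * ((159 + 2 / eta) * Y))).
      by apply: ler_wpM2l => //; lra.
    by apply: ler_wpM2r.
  have q3 : Z ^+ 2 * Y ^+ 2 <= Z ^+ 2 * Y ^+ 3.
    by rewrite ler_pM2l ?ler_weXn2l//; lra.
  have q4 : Z ^+ 2 * Y ^+ 3 * K <= A.
    rewrite AE (_ : Z ^+ 2 * Y ^+ 4 = Z ^+ 2 * Y ^+ 3 * Y); last by ring.
    by apply: ler_wpM2l => //; rewrite mulr_ge0// ?exprn_ge0//; lra.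
  have q1 : 1 <= Z ^+ 2 * Y ^+ 3.
    have : 1 <= Y ^+ 3 by rewrite exprn_ege1.
    by move=> y3; rewrite -[leLHS]mulr1; apply: ler_pM.
  apply: le_trans q4.
  rewrite (_ : Z ^+ 2 * Y ^+ 3 * K =
    Z ^+ 2 * Y ^+ 3 * 29 + 4 * (4 * (Z ^+ 2 * Y ^+ 2) * ((159 + 2 / eta) * Y)));
    last first.
    by rewrite /K; field; rewrite gt_eqF.
  by rewrite -!mulrA in m1 *; lra.
have ZX : Z <= X / 2 - 1 by rewrite /X; nra.
apply: (@le_trans _ _ (expR ((M.-1)%:R * 2^-1))).
  rewrite ler_expR; apply: (@le_trans _ _ Z).
    by apply: ler_powR => //; lra.
  by rewrite -subn1 natrB; [lra|exact: leq_trans M5].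
have e2 : expR (2^-1) <= 2 :> R.
  have := expR_ge1Dx (- 2^-1 : R); rewrite expRN => h.
  have ee := expR_gt0 (2^-1 : R).
  have : (1 + - 2^-1) * expR 2^-1 <= 1 :> R.
    by rewrite -[leRHS](mulVf (lt0r_neq0 ee)) ler_wpM2r// ltW.
  lra.
apply: (@le_trans _ _ (2 ^+ M.-1)).
  by rewrite expRM_natl lerXn2r ?nnegrE ?expR_ge0.
by rewrite -natrX ler_nat half_pow_le_size_square_nodes.
Qed.

Lemma counting_ge_size (T : choiceType) (s : seq T) (X : set T) : uniq s ->
  (forall x, x \in s -> X x) -> ((size s)%:R%:E <= @counting T R X)%E.
Proof.
move=> us sX; rewrite /counting; case: ifPn => [/asboolP fX|_];
  last by rewrite leey.
rewrite lee_fin ler_nat; apply: uniq_leq_size => // x xs.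
by rewrite in_fset_set// inE; exact: sX.
Qed.
End NodeNumber.

Theorem theorem4p1 (R : realType) :
  exists ds ds' : R,
    [/\ 0 < ds, 0 < ds' &
      forall delta : R, 0 < delta ->
      exists Adelta : R, forall A : R, Adelta <= A ->
      exists f : R[i] -> R[i],
        [/\ classC0 ds ds' f,
            expR (- A) <= cmod (f 0) &
            ((expR (A `^ (1 / 2 - delta)))%:E <= nb_zeros f)%E]].
Proof.
(* The rate 1/10 alone fixes both constants, before [delta] and [A] are given. *)
have [d [d' [d0 d'0 classP]]] :=
  @poly_classC0 R 10^-1 ltac:(by rewrite invr_gt0).
exists d, d'; split=> // delta /exists_node_number[A0 HA0]; exists A0 => A /HA0.
move=> [L [L1 A_ge0 hA hN]].
have [p [r [p0 pn ur sr rr]]] := gevrey_poly_with_roots L1 hA A_ge0.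
have [f Cf fE] := classP p pn; exists f; split=> //.
  rewrite fE ?ComplexField.Normc.normc0//.
  have -> : (map_poly (real_complex R) p).[0] = real_complex R (expR (- A)).
    by rewrite horner_coef0 coef_map p0.
  by rewrite cmod_real ger0_norm// expR_ge0.
apply: (@le_trans _ _ (size [seq (real_complex R) y | y <- r])%:R%:E).
  by rewrite size_map sr lee_fin.
apply: counting_ge_size; first by rewrite map_inj_uniq//;
  exact: (fmorph_inj (real_complex R)).
move=> _ /mapP[y /rr[/andP[y0 y1] /eqP py] ->].
have yc : cmod (real_complex R y) <= 1 by rewrite cmod_real ger0_norm.
by split=> //; rewrite /zero_set /= fE// horner_map /= py.
Qed.
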